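(* For each of the following forms of amalgamated product (with $q$ fixed), abstractly there is exactly one isomorphism class of groups of that form, with the exception of $\mathcal{Q}_{16}\ast_{\mathcal{Q}_8}\mathcal{Q}_{16}$ (which is form (d) with $q=4$), for which there are exactly two isomorphism classes: (a) $\mathbb{Z}_{4q}\ast_{\mathbb{Z}_{2q}}\mathbb{Z}_{4q}$, where $q\in\mathbb{N}$, $q\geq 1$; (b) $\mathbb{Z}_{4q}\ast_{\mathbb{Z}_{2q}}\mathrm{Dic}_{4q}$, where $q\ge2$; (c) $\mathrm{Dic}_{4q}\ast_{\mathbb{Z}_{2q}}\mathrm{Dic}_{4q}$, where $q\ge2$; (d) $\mathrm{Dic}_{4q}\ast_{\mathrm{Dic}_{2q}}\mathrm{Dic}_{4q}$, where $q\ge4$ is even; (e) $O^*\ast_{T^*}O^*$.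
   Context: $\mathbb{Z}_m$ is the cyclic group of order $m$. For $m\ge2$, $\mathrm{Dic}_{4m}=\langle x,y\mid x^m=y^2,\ yxy^{-1}=x^{-1}\rangle$ is the dicyclic group of order $4m$; $\mathcal{Q}_8=\mathrm{Dic}_8$, $\mathcal{Q}_{16}=\mathrm{Dic}_{16}$. $T^*$ and $O^*$ are the binary tetrahedral and binary octahedral groups, of orders $24$ and $48$. A group ''of the form $G_1\ast_FG_2$'' is the amalgamated product (pushout) of $G_1$ and $G_2$ along $F$ with respect to some injective homomorphisms $F\to G_1$ and $F\to G_2$ (whose images have index $2$); the statement counts isomorphism classes of the resulting abstract groups as the injective homomorphisms vary. *)

(* Defs.v *)
From mathcomp Require Import all_boot all_fingroup all_solvable.

Set Implicit Arguments.
Unset Strict Implicit.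
Unset Printing Implicit Defensive.

Local Open Scope group_scope.

(* Abstract, possibly infinite, groups are MathComp's [groupType]s. This      *)
(* structure contains a choice operator, which every type has classically,    *)
(* so no group is left out up to isomorphism.                                 *)

Definition group_iso (G H : groupType) : Prop :=
  exists f : {multiplicative G -> H}, bijective f.

Definition exactly_iso_classes (n : nat) (P : groupType -> Prop) : Prop :=
  exists s : 'I_n -> groupType,
    [/\ forall i, P (s i),
        forall i j, group_iso (s i) (s j) -> i = j
      & forall G, P G -> exists i, group_iso G (s i)].

Definition is_pushout (F G1 G2 G : groupType)
    (f1 : {multiplicative F -> G1}) (f2 : {multiplicative F -> G2})
    (i1 : {multiplicative G1 -> G}) (i2 : {multiplicative G2 -> G}) : Prop :=
  i1 \o f1 =1 i2 \o f2 /\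
  forall (H : groupType)
         (h1 : {multiplicative G1 -> H}) (h2 : {multiplicative G2 -> H}),
    h1 \o f1 =1 h2 \o f2 ->
    exists2 h : {multiplicative G -> H},
      h \o i1 =1 h1 /\ h \o i2 =1 h2
    & forall h' : {multiplicative G -> H},
        h' \o i1 =1 h1 -> h' \o i2 =1 h2 -> h' =1 h.

Definition index2_embedding (F G : finGroupType)
    (f : {multiplicative F -> G}) : Prop :=
  injective f /\ #|[set: G] : f @: [set: F]| = 2.

(* The finite groups are specified up to isomorphism: [A], [C] and [B] stand  *)
(* for the isomorphism types of the two factors and of the amalgamated group, *)
(* so that [G] is of the form A *_C B.                                        *)
Definition amalgam_form (A C B : finGroupType -> Prop) (G : groupType) : Prop :=
  exists (G1 F G2 : finGroupType)
         (f1 : {multiplicative F -> G1}) (f2 : {multiplicative F -> G2})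
         (i1 : {multiplicative G1 -> G}) (i2 : {multiplicative G2 -> G}),
    [/\ [/\ A G1, C F & B G2],
        index2_embedding f1,
        index2_embedding f2
      & is_pushout f1 f2 i1 i2].

Definition is_cyclic (m : nat) (gT : finGroupType) : Prop :=
  cyclic [set: gT] /\ #|gT| = m.

(* [\isog Grp] characterizes the largest finite quotient of the presented     *)
(* group, hence the presented group itself in the three cases below, where it *)
(* is finite (of order 4m for m >= 1, 24 and 48 respectively).                *)

Definition is_dicyclic (m : nat) (gT : finGroupType) : Prop :=
  [set: gT] \isog Grp (x : y : x ^+ m = y ^+ 2, y * x * y^-1 = x^-1).

(* The binary polyhedral groups <2,3,3> and <2,3,4>, in Coxeter's             *)
(* presentation r^2 = s^3 = t^n = rst.                                        *)

Definition is_binary_tetrahedral (gT : finGroupType) : Prop :=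
  [set: gT] \isog Grp (r : s : t :
    r ^+ 2 = r * s * t, s ^+ 3 = r * s * t, t ^+ 3 = r * s * t).

Definition is_binary_octahedral (gT : finGroupType) : Prop :=
  [set: gT] \isog Grp (r : s : t :
    r ^+ 2 = r * s * t, s ^+ 3 = r * s * t, t ^+ 4 = r * s * t).

(* Main.v *)
Require Import Defs.
From HB Require Import structures.
From mathcomp Require Import all_boot all_fingroup all_solvable.
From mathcomp Require Import boolp.

(** Every form G1 *_F G2 in the list has F of index 2 in both factors, so a factor
    is obtained from F by adjoining one element v: it is determined, together with
    the inclusion of F, by the automorphism tw of F that v induces and by the
    element v ^ 2 of F. This is [realizes_iso], where the extension with given tw
    and v ^ 2 is the concrete group [cext D]. The proof therefore consists in
    showing that an arbitrary index-2 embedding f : F -> G into a group of the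
    required isomorphism type admits an element v outside f(F) with prescribed tw
    and v ^ 2, which is what [realizes D f] says. Then every amalgam of the form is
    the pushout of two fixed inclusions F -> cext D1 and F -> cext D2, and there is
    exactly one ([one_class]).

    - F cyclic with generator c. In a cyclic group of order 4q some v has v ^ 2 = f(c)
      ([cyclic_realizes]); in a dicyclic group of order 4q some v inverts f(F), and
      v ^ 2 is the only involution of the group ([dicyclic_realizes]).

    - F dicyclic with generators X, Y, and G dicyclic with generators x, y. If f(X) is
      a power of x, it is a square x ^ 2l, and v = x ^ l satisfies v ^ 2 = f(X) and
      v f(Y) v^-1 = f(X Y) ([half_realizes]). When F has order at least 12, X has
      order greater than 4 whereas the elements outside <x> have order 4, so f(X) is
      always a power of x.

    - F = Q8 and G = Q16. One of f(X), f(Y), f(X Y) lies in <x>, since G / <x> has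
      order 2. An automorphism of F moves that one to X for the first factor; for the
      second factor a further automorphism leaves only two possibilities, the power of
      x being the image of X or that of Y. So there are at most two amalgams
      ([q16_amalgam_classes]). They are not isomorphic: the abelianization modulo
      squares has rank 3 in the first case and rank 2 in the second. The property used
      is [two_determined]: some two elements determine every homomorphism to the group
      of order 2.

    - F = T* and G = O*. An embedding lands in the standard copy of T*, because T* has
      no nontrivial homomorphism to the group of order 2, and it is the restriction of
      conjugation by an element of O* ([oct_inner]), that is, Aut T* is O* modulo its
      center. So the standard v, conjugated, works ([octahedral_realizes]).

    Two ingredients give existence. Amalgams are built as words modulo having the same
    value under every compatible pair of homomorphisms ([amalgam_pushout]). The finite
    groups are iterated cyclic extensions: Dic from a cyclic group, T* from Q8 in degree
    3, O* from T* in degree 2. Each has a universal property by generators and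
    relations, and matching it with the given presentation is elementary except for one
    point: in the presentations of T* and O* the central element z = rst satisfies
    z ^ 2 = 1, because z is conjugate to its inverse ([tet_z2], [oct_z2]). *)

Set Implicit Arguments.
Unset Strict Implicit.
Unset Printing Implicit Defensive.

Local Open Scope group_scope.

(** * Homomorphisms *)

Section Homs.
Variables (G H : groupType) (f : {multiplicative G -> H}).

Lemma hom1 : f 1 = 1.
Proof. by apply: (@mulgI H (f 1)); rewrite -gmulfM !mulg1. Qed.

Lemma homV x : f x^-1 = (f x)^-1.
Proof. by apply: (@mulgI H (f x)); rewrite -gmulfM !mulgV hom1. Qed.

Lemma homX x n : f (x ^+ n) = f x ^+ n.
Proof. by elim: n => [|n IHn]; rewrite ?hom1 // !expgS gmulfM IHn. Qed.

End Homs.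

Definition mkhom (G H : groupType) (f : G -> H)
    (fM : {morph f : x y / x * y}) : {multiplicative G -> H} :=
  HB.pack f (isMultiplicative.Build G H f fM).

Lemma group_iso_sym (G H : groupType) : group_iso G H -> group_iso H G.
Proof.
move=> [f [g fK gK]]; exists (mkhom (can2_gmulfM fK gK)).
by exists f.
Qed.

(** * Amalgamated products *)

Section Amalgam.
Local Open Scope quotient_scope.
Variables (F G1 G2 : groupType).
Variables (f1 : {multiplicative F -> G1}) (f2 : {multiplicative F -> G2}).

Definition word_eval (H : groupType) (h1 : G1 -> H) (h2 : G2 -> H)
    (w : seq (G1 + G2)) : H :=
  foldr (fun s => mul (match s with inl a => h1 a | inr b => h2 b end)) 1 w.

Lemma word_eval_cat H h1 h2 w w' :
  @word_eval H h1 h2 (w ++ w') = word_eval h1 h2 w * word_eval h1 h2 w'.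
Proof. by elim: w => [|s w IHw] /=; rewrite ?mul1g // IHw mulgA. Qed.

(** Quantifying over all compatible pairs, instead of generating a congruence by
    rewriting rules, makes the universal property of the quotient immediate; its price
    is that equality of words is decided classically. *)
Definition same_value (w w' : seq (G1 + G2)) : Prop :=
  forall (H : groupType)
    (h1 : {multiplicative G1 -> H}) (h2 : {multiplicative G2 -> H}),
  h1 \o f1 =1 h2 \o f2 -> word_eval h1 h2 w = word_eval h1 h2 w'.

Definition same_valueb : rel (seq (G1 + G2)) :=
  fun w w' => `[< same_value w w' >].

Lemma same_value_equiv : equiv_class_of same_valueb.
Proof.
split=> [w|w w'|w2 w1 w3].
- exact/asboolP.
- by apply/asboolP/asboolP => E H h1 h2 e; rewrite E.
- by move=> /asboolP E1 /asboolP E2; apply/asboolP => H h1 h2 e; rewrite E1 ?E2.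
Qed.

Canonical same_value_equivRel := EquivRelPack same_value_equiv.

Definition amalgam : Type := {eq_quot same_valueb}.
HB.instance Definition _ := Choice.on amalgam.
HB.instance Definition _ := EqQuotient.on amalgam.

Local Notation word_of p := (generic_quotient.repr p).

Definition amalgam_eval (H : groupType) (h1 : G1 -> H) (h2 : G2 -> H)
  (p : amalgam) : H := word_eval h1 h2 (word_of p).

Section Eval.
Variables (H : groupType).
Variables (h1 : {multiplicative G1 -> H}) (h2 : {multiplicative G2 -> H}).
Hypothesis e : h1 \o f1 =1 h2 \o f2.

Lemma amalgam_eval_pi w : amalgam_eval h1 h2 (\pi_amalgam w) = word_eval h1 h2 w.
Proof.
rewrite /amalgam_eval; case: piP => w' /eqmodP /asboolP E.
by rewrite (E H h1 h2 e).
Qed.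
End Eval.

Lemma amalgam_ext (p q : amalgam) :
  (forall (H : groupType)
    (h1 : {multiplicative G1 -> H}) (h2 : {multiplicative G2 -> H}),
    h1 \o f1 =1 h2 \o f2 -> amalgam_eval h1 h2 p = amalgam_eval h1 h2 q) -> p = q.
Proof.
by move=> E; rewrite -[p]reprK -[q]reprK; apply/eqmodP/asboolP => H h1 h2 /E.
Qed.

Definition amalgam_one : amalgam := \pi_amalgam [::].
Definition amalgam_mul (p q : amalgam) : amalgam :=
  \pi_amalgam (word_of p ++ word_of q).
Definition inv_letter (s : G1 + G2) : G1 + G2 :=
  match s with inl a => inl a^-1 | inr b => inr b^-1 end.
Definition amalgam_inv (p : amalgam) : amalgam :=
  \pi_amalgam (rev (map inv_letter (word_of p))).

Section EvalHom.
Variables (H : groupType).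
Variables (h1 : {multiplicative G1 -> H}) (h2 : {multiplicative G2 -> H}).
Hypothesis e : h1 \o f1 =1 h2 \o f2.

Lemma amalgam_eval1 : amalgam_eval h1 h2 amalgam_one = 1.
Proof. by rewrite amalgam_eval_pi. Qed.

Lemma amalgam_evalM p q : amalgam_eval h1 h2 (amalgam_mul p q)
  = amalgam_eval h1 h2 p * amalgam_eval h1 h2 q.
Proof. by rewrite amalgam_eval_pi // word_eval_cat. Qed.

Lemma amalgam_evalV p :
  amalgam_eval h1 h2 (amalgam_inv p) = (amalgam_eval h1 h2 p)^-1.
Proof.
rewrite amalgam_eval_pi // /amalgam_eval; elim: (word_of p) => [|s w IHw] /=.
  by rewrite invg1.
rewrite rev_cons -cats1 word_eval_cat IHw /= mulg1 invgM.
by case: s => a /=; rewrite homV.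
Qed.
End EvalHom.

Fact amalgam_mulA : associative amalgam_mul.
Proof.
by move=> p q r; apply: amalgam_ext => H h1 h2 e; rewrite !amalgam_evalM // mulgA.
Qed.

Fact amalgam_mul1 : left_id amalgam_one amalgam_mul.
Proof.
move=> p; apply: amalgam_ext => H h1 h2 e.
by rewrite amalgam_evalM // amalgam_eval1 // mul1g.
Qed.

Fact amalgam_mulr1 : right_id amalgam_one amalgam_mul.
Proof.
move=> p; apply: amalgam_ext => H h1 h2 e.
by rewrite amalgam_evalM // amalgam_eval1 // mulg1.
Qed.

Fact amalgam_mulV : left_inverse amalgam_one amalgam_inv amalgam_mul.
Proof.
move=> p; apply: amalgam_ext => H h1 h2 e.
by rewrite amalgam_evalM // amalgam_evalV // amalgam_eval1 // mulVg.
Qed.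

Fact amalgam_mulrV : right_inverse amalgam_one amalgam_inv amalgam_mul.
Proof.
move=> p; apply: amalgam_ext => H h1 h2 e.
by rewrite amalgam_evalM // amalgam_evalV // amalgam_eval1 // mulgV.
Qed.

HB.instance Definition _ := isGroup.Build amalgam
  amalgam_mulA amalgam_mul1 amalgam_mulr1 amalgam_mulV amalgam_mulrV.

Definition amalgam_inl_fun (a : G1) : amalgam := \pi_amalgam [:: inl a].
Definition amalgam_inr_fun (b : G2) : amalgam := \pi_amalgam [:: inr b].

Fact amalgam_inl_M : {morph amalgam_inl_fun : a b / a * b}.
Proof.
move=> a b; apply: amalgam_ext => H h1 h2 e.
by rewrite amalgam_evalM // !amalgam_eval_pi //= !mulg1 gmulfM.
Qed.

Fact amalgam_inr_M : {morph amalgam_inr_fun : a b / a * b}.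
Proof.
move=> a b; apply: amalgam_ext => H h1 h2 e.
by rewrite amalgam_evalM // !amalgam_eval_pi //= !mulg1 gmulfM.
Qed.

Definition amalgam_inl := mkhom amalgam_inl_M.
Definition amalgam_inr := mkhom amalgam_inr_M.

(** An element is the product of the letters of any word representing it, so the
    factors generate; this gives uniqueness in the universal property. *)
Lemma amalgam_repr (p : amalgam) :
  word_eval amalgam_inl amalgam_inr (word_of p) = p.
Proof.
apply: amalgam_ext => H h1 h2 e; rewrite /amalgam_eval -/(amalgam_eval h1 h2 _).
elim: (word_of p) => [|s w IHw] /=; first by rewrite amalgam_eval1.
by rewrite amalgam_evalM // IHw; case: s => a; rewrite amalgam_eval_pi //= mulg1.
Qed.

End Amalgam.

Lemma pushout_hom_ext (F G1 G2 P : groupType)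
    (f1 : {multiplicative F -> G1}) (f2 : {multiplicative F -> G2})
    (i1 : {multiplicative G1 -> P}) (i2 : {multiplicative G2 -> P})
    (H : groupType) (h h' : {multiplicative P -> H}) :
  is_pushout f1 f2 i1 i2 -> h \o i1 =1 h' \o i1 -> h \o i2 =1 h' \o i2 -> h =1 h'.
Proof.
case=> e univ e1 e2; have [x|k _ kU] := univ H (h \o i1) (h \o i2).
  by congr (h _); apply: e.
by move=> x; rewrite (kU h) ?(kU h') // => y; rewrite -?e1 -?e2.
Qed.

Lemma amalgam_pushout (F G1 G2 : groupType)
    (f1 : {multiplicative F -> G1}) (f2 : {multiplicative F -> G2}) :
  is_pushout f1 f2 (amalgam_inl f1 f2) (amalgam_inr f1 f2).
Proof.
split=> [x|H h1 h2 e].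
  apply: amalgam_ext => H h1 h2 e.
  by rewrite !amalgam_eval_pi //= !mulg1; apply: e.
exists (mkhom (amalgam_evalM e)) => [|h' e1 e2 p].
  by split=> x; rewrite /= amalgam_eval_pi //= mulg1.
rewrite -[in LHS](amalgam_repr p) /= /amalgam_eval.
elim: (generic_quotient.repr p) => [|s w IHw] /=; first by rewrite hom1.
by rewrite gmulfM IHw; case: s => a; rewrite -?e1 -?e2.
Qed.

Lemma pushout_unique (F G1 G2 P Q : groupType)
    (f1 : {multiplicative F -> G1}) (f2 : {multiplicative F -> G2})
    (i1 : {multiplicative G1 -> P}) (i2 : {multiplicative G2 -> P})
    (j1 : {multiplicative G1 -> Q}) (j2 : {multiplicative G2 -> Q}) :
  is_pushout f1 f2 i1 i2 -> is_pushout f1 f2 j1 j2 -> group_iso P Q.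
Proof.
move=> pP pQ; have [h [h1 h2] _] := pP.2 Q j1 j2 pQ.1.
have [k [k1 k2] _] := pQ.2 P i1 i2 pP.1.
exists h; exists k.
- apply: (pushout_hom_ext (h := k \o h) (h' := idfun) pP) => x /=.
    by rewrite [h _]h1 [k _]k1.
  by rewrite [h _]h2 [k _]k2.
- apply: (pushout_hom_ext (h := h \o k) (h' := idfun) pQ) => x /=.
    by rewrite [k _]k1 [h _]h1.
  by rewrite [k _]k2 [h _]h2.
Qed.

(** Only the spans have to be isomorphic: the isomorphism of F may be arbitrary as
    long as the isomorphisms of the factors extend it. *)
Lemma pushout_transport (F F' G1 G2 G1' G2' P : groupType)
    (f1 : {multiplicative F -> G1}) (f2 : {multiplicative F -> G2})
    (f1' : {multiplicative F' -> G1'}) (f2' : {multiplicative F' -> G2'})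
    (i1 : {multiplicative G1' -> P}) (i2 : {multiplicative G2' -> P})
    (c : {multiplicative F -> F'})
    (a1 : {multiplicative G1 -> G1'}) (a2 : {multiplicative G2 -> G2'}) :
  bijective c -> bijective a1 -> bijective a2 ->
  a1 \o f1 =1 f1' \o c -> a2 \o f2 =1 f2' \o c ->
  is_pushout f1' f2' i1 i2 -> is_pushout f1 f2 (i1 \o a1) (i2 \o a2).
Proof.
move=> [c' cK c'K] [b1 a1K b1K] [b2 a2K b2K] e1 e2 [e univ]; split=> [x|H h1 h2 eh].
  by rewrite /= [a1 _]e1 [a2 _]e2; apply: e.
have [|h [hE1 hE2] hU] := univ H (h1 \o mkhom (can2_gmulfM a1K b1K))
                               (h2 \o mkhom (can2_gmulfM a2K b2K)).
  move=> x /=; rewrite -[x]c'K; move: (e1 (c' x)) (e2 (c' x)) => /= <- <-.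
  by rewrite a1K a2K; apply: eh.
exists h.
  split=> x /=; first by have /= -> := hE1 (a1 x); rewrite a1K.
  by have /= -> := hE2 (a2 x); rewrite a2K.
move=> h' h'1 h'2; apply: hU => x /=.
  by have /= <- := h'1 (b1 x); rewrite b1K.
by have /= <- := h'2 (b2 x); rewrite b2K.
Qed.

(** * Index two and presentations *)

Section FiniteHoms.
Variables (gT rT : finGroupType) (f : {multiplicative gT -> rT}).

Definition hom_morphism : {morphism [set: gT] >-> rT} :=
  Morphism (in2W (@gmulfM gT rT f)).

Lemma hom_image_morphim : f @: [set: gT] = hom_morphism @* [set: gT].
Proof. by rewrite morphimEdom. Qed.

(** Index 2 is a statement about orders, by Lagrange. *)
Lemma index2_embeddingE :
  injective f -> index2_embedding f <-> #|rT| = (2 * #|gT|)%N.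
Proof.
move=> f_inj; have cf : #|hom_morphism @* [set: gT]| = #|gT|.
  by rewrite -hom_image_morphim card_imset // cardsT.
rewrite /index2_embedding hom_image_morphim.
have := Lagrange (subsetT (hom_morphism @* [set: gT])).
rewrite cf cardsT mulnC => <-; split=> [[_ ->] //|/eqP].
by rewrite eqn_pmul2r -?cardsT ?cardG_gt0 // => /eqP.
Qed.

Lemma index2_card : index2_embedding f -> #|rT| = (2 * #|gT|)%N.
Proof. by move=> if2; apply/(index2_embeddingE if2.1). Qed.

End FiniteHoms.

Lemma isog_group_iso (gT rT : finGroupType) :
  [set: gT] \isog [set: rT] -> group_iso gT rT.
Proof.
case/isogP=> f f_inj f_im.
have fM : {morph f : x y / x * y} by move=> x y; rewrite morphM ?inE.
exists (mkhom fM); apply: inj_card_bij => [x y|].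
  by apply: (injmP f_inj); rewrite inE.
by rewrite -!cardsT -f_im card_injm.
Qed.

(** Each of the two groups is a quotient of the other, and both are finite. *)
Lemma presented_iso (gT rT : finGroupType) p :
  [set: gT] \isog Grp p -> [set: rT] \isog Grp p -> group_iso gT rT.
Proof.
move=> gp rp; apply: isog_group_iso; rewrite isogEhom.
by rewrite (rp _ [group of [set: gT]]) (gp _ [group of [set: rT]])
  (isoGrp_hom (G := [group of [set: gT]]) gp) (isoGrp_hom (G := [group of [set: rT]]) rp).
Qed.

Lemma hom_inj (F G : finGroupType) (f : {multiplicative F -> G}) :
  (forall x, f x = 1 -> x = 1) -> injective f.
Proof.
move=> f1 x y exy; apply: divg1_eq; apply: f1.
by rewrite gmulfM homV exy mulgV.
Qed.

Lemma surj_card_bij (G H : finGroupType) (f : {multiplicative G -> H}) :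
  (forall y, exists x, f x = y) -> #|G| <= #|H| -> bijective f.
Proof.
move=> surj le_GH; have cH : #|codom f| = #|H|.
  by apply: eq_card => y; have [x <-] := surj y; rewrite codom_f inE.
have le_HG : #|H| <= #|G| by rewrite -cH leq_image_card.
have /image_injP f_inj : #|codom f| == #|G| by rewrite cH eqn_leq le_HG.
by apply: inj_card_bij => // x y; apply: f_inj.
Qed.

Lemma order_hom_inj (G H : finGroupType) (f : {multiplicative G -> H}) a :
  injective f -> #[f a] = #[a].
Proof.
move=> f_inj; apply: (order_injm (f := hom_morphism f)); rewrite ?inE //.
by apply/injmP=> x y _ _; apply: f_inj.
Qed.

Lemma homg_joing2 (G H : finGroupType) (h : {multiplicative G -> H}) (a b : G) :
  [set: G] = <[a]> <*> <[b]> -> <[h a]> <*> <[h b]> \homg [set: G].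
Proof.
move=> Gab; apply/homgP; exists (hom_morphism h).
transitivity (hom_morphism h @* (<[a]> <*> <[b]>)); first by rewrite -Gab.
by rewrite morphimY ?subsetT // !morphim_cycle ?inE.
Qed.

Lemma homg_joing3 (G H : finGroupType) (h : {multiplicative G -> H}) (r s t : G) :
  [set: G] = <[r]> <*> <[s]> <*> <[t]> ->
  <[h r]> <*> <[h s]> <*> <[h t]> \homg [set: G].
Proof.
move=> Grst; apply/homgP; exists (hom_morphism h).
transitivity (hom_morphism h @* (<[r]> <*> <[s]> <*> <[t]>)); first by rewrite -Grst.
by rewrite !morphimY ?subsetT // !morphim_cycle ?inE.
Qed.

Lemma joing3_setT (G : finGroupType) (a b c : G) :
    (forall A : {group G}, a \in A -> b \in A -> c \in A -> A = [set: G] :> {set G}) ->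
  [set: G] = <[a]> <*> <[b]> <*> <[c]>.
Proof.
move=> gen; have subl (B C : {set G}) := subsetP (joing_subl B C).
have subr (B C : {set G}) := subsetP (joing_subr B C).
apply/esym/(gen (joing_group (<[a]> <*> <[b]>) <[c]>)) => /=.
- by apply/subl/subl/cycle_id.
- by apply/subl/subr/cycle_id.
- by apply/subr/cycle_id.
Qed.

(** * Cyclic extensions *)

(** The data of an extension of the cyclic group of order n by F, seen from a lift v of
    a generator: [tw] is conjugation by v on F and [top] is v ^ n. The two conditions
    say that v commutes with v ^ n and that tw ^ n is conjugation by v ^ n. *)
Record cext_data (F : finGroupType) (n : nat) := CextData {
  tw : {multiplicative F -> F};
  top : F;
  tw_top : tw top = top;
  tw_iter : forall x, iter n tw x * top = top * x
}.

Section CyclicExtension.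
Variables (F : finGroupType) (n' : nat).
Local Notation n := n'.+1.

(** The pair (a, i) stands for the normal form a * v ^ i. *)
Definition cext of cext_data F n : Type := (F * 'I_n)%type.
HB.instance Definition _ D := Finite.on (cext D).

Variable D : cext_data F n.
Local Notation E := (cext D).
Local Notation k := (top D).

Definition twi i : F -> F := iter i (tw D).

Lemma twiM i : {morph twi i : x y / x * y}.
Proof. by move=> x y; elim: i => //= i ->; rewrite gmulfM. Qed.

Definition twi_hom i := mkhom (twiM i).

Lemma twiV i : {morph twi i : x / x^-1}.
Proof. exact: (homV (twi_hom i)). Qed.

Lemma twiD i j x : twi (i + j)%N x = twi i (twi j x).
Proof. exact: iterD. Qed.

Lemma twi_top i j : twi i (k ^+ j) = k ^+ j.
Proof.
rewrite [LHS](homX (twi_hom i)) /= /twi; congr (_ ^+ _).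
by elim: i => //= i ->; rewrite tw_top.
Qed.

(** Replacing v ^ i by v ^ (i mod n) costs a power of v ^ n, which absorbs the
    difference between the two conjugations. *)
Lemma twi_mod i x : k ^+ (i %/ n) * twi (i %% n) x = twi i x * k ^+ (i %/ n).
Proof.
have -> : twi i x = twi (i %% n) (twi (i %/ n * n)%N x).
  by rewrite -twiD addnC -divn_eq.
suff E m y : twi (m * n)%N y * k ^+ m = k ^+ m * y.
  rewrite -[in RHS](twi_top (i %% n)) -twiM E twiM twi_top //.
elim: m y => [|m IHm] y; first by rewrite mulg1 mul1g.
by rewrite mulSn twiD expgS mulgA tw_iter -mulgA IHm mulgA.
Qed.

Lemma mod_ltn i : (i %% n < n)%N. Proof. by rewrite ltn_mod. Qed.
Definition pow_ord i : 'I_n := Ordinal (mod_ltn i).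

Definition cext_one : E := (1, ord0).
Definition cext_mul (p q : E) : E :=
  (p.1 * twi p.2 q.1 * k ^+ ((p.2 + q.2) %/ n)%N, pow_ord (p.2 + q.2)%N).
Definition cext_inv (p : E) : E :=
  (twi (n - p.2) (k^-1 * p.1^-1) * k ^+ ((n - p.2) %/ n), pow_ord (n - p.2)).

Fact cext_mulA : associative cext_mul.
Proof.
move=> [a i] [b j] [c l]; congr (_, _); last first.
  by apply: val_inj; rewrite /= modnDml modnDmr addnA.
rewrite /= !twiM twi_top !mulgA -twiD -[in RHS](mulgA (a * _)) twi_mod !mulgA.
rewrite -[LHS]mulgA -[RHS]mulgA -!expgnDr; congr (_ * k ^+ _).
by rewrite -!divnMDl // addnCA -divn_eq [in RHS]addnA -divn_eq addnA.
Qed.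

Fact cext_mul1 : left_id cext_one cext_mul.
Proof.
move=> [a i]; congr (_, _); last by apply: val_inj; rewrite /= add0n modn_small.
by rewrite /= mul1g add0n divn_small // mulg1.
Qed.

Fact cext_mulV : left_inverse cext_one cext_inv cext_mul.
Proof.
move=> [a i]; congr (_, _); last first.
  by apply: val_inj; rewrite /= modnDml subnK ?modnn // ltnW.
rewrite /= -(mulgA _ (k ^+ ((n - i) %/ n))) twi_mod !mulgA -twiM mulgVK.
rewrite -mulgA -expgnDr -divnMDl // addnA -divn_eq subnK; last exact/ltnW.
by rewrite divnn twiV (twi_top _ 1) mulVg.
Qed.

HB.instance Definition _ := Finite_isGroup.Build E
  cext_mulA cext_mul1 cext_mulV.

Fact cext_base_M : {morph (fun a : F => (a, ord0) : E) : a b / a * b}.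
Proof.
move=> a b; congr (_, _); first by rewrite /= addn0 divn_small // mulg1.
exact: val_inj.
Qed.
Definition cext_base : {multiplicative F -> E} := mkhom cext_base_M.

(** In degree 1 the adjoined element already lies in F, whence the exponent, which is 0
    in all other degrees. *)
Definition cext_gen : E := (k ^+ (1 %/ n), pow_ord 1).

Lemma cext_base_inj : injective cext_base.
Proof. by move=> a b []. Qed.

Lemma card_cext : #|{: E}| = (#|F| * n)%N.
Proof. by rewrite card_prod card_ord. Qed.

(** Multiplication is a carry: every n-th power of v is moved into F. *)
Lemma cext_genX i : cext_gen ^+ i = (k ^+ (i %/ n), pow_ord i) :> E.
Proof.
elim: i => [|i IHi].
  by rewrite div0n; congr (_, _); apply: val_inj; rewrite /= mod0n.
rewrite expgSr IHi; congr (_, _); last first.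
  by apply: val_inj; rewrite /= modnDm addn1.
rewrite /= twi_top -!expgnDr; congr (_ ^+ _).
by rewrite -addnA -!divnMDl // (addnCA (1 %/ n * n)%N) -divn_eq addnA -divn_eq addn1.
Qed.

Lemma cext_genXn : cext_gen ^+ n = cext_base k.
Proof.
by rewrite cext_genX divnn expg1; congr (_, _); apply: val_inj; rewrite /= modnn.
Qed.

Lemma cext_eq (p : E) : p = cext_base p.1 * cext_gen ^+ p.2.
Proof.
case: p => a i; rewrite cext_genX; congr (_, _); last first.
  by apply: val_inj; rewrite /= add0n modn_mod modn_small.
by rewrite /= add0n !divn_small ?modn_mod ?ltn_mod ?modn_small ?mulg1.
Qed.

Lemma cext_gen_base x : cext_gen * cext_base x = cext_base (tw D x) * cext_gen.
Proof.
congr (_, _); last by apply: val_inj; rewrite /= addn0 add0n modn_mod.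
rewrite /= addn0 add0n [((1 %% _) %/ _)%N]divn_small ?ltn_mod // expg0 !mulg1.
by rewrite twi_mod.
Qed.

Section Lift.
Variables (H : groupType) (h : {multiplicative F -> H}) (v : H).
Hypotheses (vn : v ^+ n = h k) (vh : forall x, v * h x = h (tw D x) * v).

(** The universal property of the extension: a homomorphism on F and an element
    subject to the two relations of v. *)
Lemma cext_lift_M : {morph (fun p : E => h p.1 * v ^+ p.2) : p q / p * q}.
Proof.
have vXh i x : v ^+ i * h x = h (twi i x) * v ^+ i.
  elim: i => [|i IHi]; first by rewrite mulg1 mul1g.
  by rewrite expgS -mulgA IHi mulgA vh -mulgA.
move=> [a i] [b j]; rewrite /= !gmulfM homX -vn -!expgnA -!mulgA; congr mul.
by rewrite [in RHS]mulgA vXh -!mulgA -!expgnDr mulnC -divn_eq.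
Qed.
Definition cext_lift : {multiplicative E -> H} := mkhom cext_lift_M.

Lemma cext_lift_base x : cext_lift (cext_base x) = h x.
Proof. exact: mulg1. Qed.

Lemma cext_lift_gen : cext_lift cext_gen = v.
Proof. by rewrite /= homX -vn -expgnA -expgnDr mulnC -divn_eq. Qed.
End Lift.

Lemma cext_hom_ext (H : groupType) (h h' : {multiplicative E -> H}) :
  h \o cext_base =1 h' \o cext_base -> h cext_gen = h' cext_gen -> h =1 h'.
Proof. by move=> e eg p; rewrite (cext_eq p) !gmulfM !homX eg [h _]e. Qed.

Lemma cext_generated (A : {group E}) :
  (forall x, cext_base x \in A) -> cext_gen \in A -> A = [set: E] :> {set E}.
Proof.
move=> Ab Ag; apply/setP=> p; rewrite inE (cext_eq p).
by rewrite groupM ?groupX.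
Qed.

End CyclicExtension.

(** * Amalgams determined by extension data *)

Lemma index2_embedding_comp (F F' G : finGroupType)
    (f : {multiplicative F -> G}) (c : {multiplicative F' -> F}) :
  bijective c -> index2_embedding f -> index2_embedding (f \o c).
Proof.
move=> bc if2; have fc_inj := inj_comp if2.1 (bij_inj bc).
apply/(index2_embeddingE fc_inj).
by rewrite (bij_eq_card bc) (index2_card if2).
Qed.

Section Degree2.
Variables (F : finGroupType) (D : cext_data F 2).

Lemma cext_base_index2 : index2_embedding (cext_base D).
Proof.
by apply/(index2_embeddingE (@cext_base_inj _ _ D)); rewrite card_cext mulnC.
Qed.

(** Some element outside f(F) satisfies the relations of the adjoined element of
    [cext D]. *)
Definition realizes (G : finGroupType) (f : {multiplicative F -> G}) :=
  exists v : G, [/\ forall x, f x <> v, v ^+ 2 = f (top D)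
                  & forall x, v * f x = f (tw D x) * v].

(** The lift of f to the extension is injective because v is not in f(F), hence
    bijective because both groups have order twice that of F. *)
Lemma realizes_iso (G : finGroupType) (f : {multiplicative F -> G}) :
  index2_embedding f -> realizes f ->
  exists2 t : {multiplicative cext D -> G}, bijective t & t \o cext_base D =1 f.
Proof.
move=> if2 [v [fNv v2 vf]]; exists (cext_lift v2 vf); last first.
  by move=> x; rewrite /= mulg1.
apply: inj_card_bij; last by rewrite card_cext mulnC -(index2_card if2).
apply: hom_inj => -[a [[|[|//]] lti]] /= E.
  congr (_, _); last exact: val_inj.
  by apply: if2.1; rewrite hom1 -E mulg1.
by case: (fNv a^-1); rewrite homV; apply: mulg1_eq.
Qed.

End Degree2.

(** Both sides are rewritten over the fixed group F0. The involution s accounts for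
    embeddings that realize the data only after a change of coordinates of F0 that
    cannot be absorbed on the other side. *)
Lemma pushout_model (F F0 G1 G2 : finGroupType) (P : groupType)
    (f1 : {multiplicative F -> G1}) (f2 : {multiplicative F -> G2})
    (i1 : {multiplicative G1 -> P}) (i2 : {multiplicative G2 -> P})
    (c : {multiplicative F0 -> F}) (s : {multiplicative F0 -> F0})
    (D1 D2 : cext_data F0 2) :
    bijective c -> involutive s -> index2_embedding f1 -> index2_embedding f2 ->
    realizes D1 (f1 \o c) -> realizes D2 (f2 \o c \o s) ->
    is_pushout f1 f2 i1 i2 ->
  exists (j1 : {multiplicative cext D1 -> P}) (j2 : {multiplicative cext D2 -> P}),
    is_pushout (cext_base D1) (cext_base D2 \o s) j1 j2.
Proof.
move=> bc sK if1 if2 r1 r2 pP.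
have [|t1 bt1 t1E] := realizes_iso _ r1; first exact: index2_embedding_comp.
have [|t2 bt2 t2E] := realizes_iso _ r2.
  by apply: index2_embedding_comp; [exact: inv_bij|apply: index2_embedding_comp].
exists (i1 \o t1), (i2 \o t2); apply: pushout_transport bc bt1 bt2 t1E _ pP.
by move=> x; have /= -> := t2E (s x); rewrite sK.
Qed.

(** If the type of each factor forces every index-2 embedding to realize fixed data,
    the form has a single model. *)
Lemma one_class (A C B : finGroupType -> Prop) (F0 : finGroupType)
    (D1 D2 : cext_data F0 2) :
    C F0 -> (forall F, C F -> group_iso F0 F) ->
    A (cext D1) -> (forall (G : finGroupType) (f : {multiplicative F0 -> G}),
      A G -> index2_embedding f -> realizes D1 f) ->
    B (cext D2) -> (forall (G : finGroupType) (f : {multiplicative F0 -> G}),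
      B G -> index2_embedding f -> realizes D2 f) ->
  exactly_iso_classes 1 (amalgam_form A C B).
Proof.
move=> CF0 Cuniq AE1 rA BE2 rB.
pose f2 : {multiplicative F0 -> _} := cext_base D2 \o idfun.
exists (fun=> amalgam (cext_base D1) f2); split.
- move=> _; exists (cext D1), F0, (cext D2), (cext_base D1), f2.
  exists (amalgam_inl (cext_base D1) f2), (amalgam_inr (cext_base D1) f2).
  split=> //; [exact: cext_base_index2| |exact: amalgam_pushout].
  by apply: index2_embedding_comp; [exists idfun|exact: cext_base_index2].
- by move=> i j _; rewrite !ord1.
move=> P [G1 [F [G2 [g1 [g2 [i1 [i2 [[AG1 CF BG2] if1 if2 pP]]]]]]]].
exists ord0; have [c bc] := Cuniq F CF.
have ifc1 := index2_embedding_comp bc if1.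
have ifc2 : index2_embedding (g2 \o c \o idfun).
  by apply: index2_embedding_comp; [exists idfun|apply: index2_embedding_comp].
have [//|j1 [j2 pj]] := pushout_model bc _ if1 if2 (rA _ _ AG1 ifc1) (rB _ _ BG2 ifc2) pP.
exact: pushout_unique pj (amalgam_pushout _ _).
Qed.

(** * Cyclic groups *)

(** Cyclic groups are extensions of the trivial group, so that they share the universal
    property of extensions. *)
Definition trivial : Type := unit.
HB.instance Definition _ := Finite.on trivial.

Fact trivial_mulA : associative (fun _ _ : trivial => tt : trivial).
Proof. by []. Qed.
Fact trivial_mul1 : left_id (tt : trivial) (fun _ _ : trivial => tt : trivial).
Proof. by case. Qed.
Fact trivial_mulV :
  left_inverse (tt : trivial) (fun _ => tt) (fun _ _ : trivial => tt : trivial).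
Proof. by []. Qed.
HB.instance Definition _ := Finite_isGroup.Build trivial
  trivial_mulA trivial_mul1 trivial_mulV.

Lemma trivial_eq (a b : trivial) : a = b. Proof. by case: a b => [] []. Qed.

Definition triv_data n : cext_data trivial n :=
  @CextData trivial n idfun 1 erefl (fun x => trivial_eq _ _).

(** The predecessor makes the degree visibly positive; for n > 0 the order is n. *)
Definition cyc n : finGroupType := cext (triv_data n.-1.+1).
Definition cgen n : cyc n := cext_gen (triv_data n.-1.+1).

Section Cyc.
Variables (n : nat) (n_gt0 : 0 < n).

Lemma cyc_form (a : cyc n) : exists i, a = cgen n ^+ i.
Proof.
exists a.2; rewrite [LHS]cext_eq.
have -> : a.1 = 1 by exact: trivial_eq.
by rewrite hom1 mul1g.
Qed.

Lemma card_cyc : #|cyc n| = n.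
Proof. by rewrite card_cext card_unit mul1n prednK. Qed.

Lemma order_cgen : #[cgen n] = n.
Proof.
rewrite -[RHS]card_cyc -cardsT orderE; congr #|pred_of_set _|; apply/setP=> a.
by rewrite inE; have [i ->] := cyc_form a; rewrite mem_cycle.
Qed.

Lemma cgenX_eq1 i : (cgen n ^+ i == 1) = (n %| i).
Proof. by rewrite -order_dvdn order_cgen. Qed.

Lemma cyc_lift (H : groupType) (v : H) :
  v ^+ n = 1 -> {h : {multiplicative cyc n -> H} | h (cgen n) = v}.
Proof.
move=> vn; have vn' : v ^+ n.-1.+1 = @one_fun trivial H (top (triv_data n.-1.+1)).
  by rewrite prednK.
have vh x : v * @one_fun trivial H x = one_fun _ (tw (triv_data n.-1.+1) x) * v.
  by rewrite mulg1 mul1g.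
by exists (cext_lift vn' vh); apply: cext_lift_gen.
Qed.

End Cyc.

Lemma cgenX n : cgen n ^+ n = 1.
Proof. by case: n => // n; have := expg_order (cgen n.+1); rewrite order_cgen. Qed.

Lemma cyc_commute n (a b : cyc n) : commute a b.
Proof.
have [[i ->] [j ->]] := (cyc_form a, cyc_form b).
by apply: commuteX2.
Qed.

Lemma is_cyclic_cyc n : 0 < n -> is_cyclic n (cyc n).
Proof.
move=> n_gt0; split; last exact: card_cyc.
apply/cyclicP; exists (cgen n); apply/setP=> a; rewrite inE.
by have [i ->] := cyc_form a; rewrite mem_cycle.
Qed.

Lemma is_cyclic_iso n G : 0 < n -> is_cyclic n G -> group_iso (cyc n) G.
Proof.
move=> n_gt0 [cG oG]; apply: isog_group_iso.
have [cC oC] := is_cyclic_cyc n_gt0.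
by rewrite isog_cyclic_card // cG !cardsT oG oC /=.
Qed.

(** * Dicyclic groups *)

Lemma cyc_invM n : {morph (fun a : cyc n => a^-1) : a b / a * b}.
Proof. by move=> a b; rewrite (cyc_commute a b) /= invgM. Qed.

Lemma dic_top m : (cgen (2 * m) ^+ m)^-1 = cgen (2 * m) ^+ m.
Proof. by apply: mulg1_eq; rewrite -expgnDr addnn -mul2n cgenX. Qed.

Lemma dic_iter n (t a : cyc n) : a^-1^-1 * t = t * a.
Proof. by rewrite invgK cyc_commute. Qed.

Definition dic_data m : cext_data (cyc (2 * m)) 2 :=
  @CextData _ 2 (mkhom (@cyc_invM (2 * m))) (cgen (2 * m) ^+ m)
    (dic_top m) (@dic_iter (2 * m) (cgen (2 * m) ^+ m)).

Definition dic m : finGroupType := cext (dic_data m).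
Definition dicx m : dic m := cext_base (dic_data m) (cgen (2 * m)).
Definition dicy m : dic m := cext_gen (dic_data m).

Definition dic_rel m (G : groupType) (x y : G) :=
  x ^+ m = y ^+ 2 /\ y * x = x^-1 * y.

Lemma dic_rel_hom m (G H : groupType) (f : {multiplicative G -> H}) x y :
  dic_rel m x y -> dic_rel m (f x) (f y).
Proof. by move=> [e1 e2]; split; rewrite -?homX ?e1 // -gmulfM e2 gmulfM homV. Qed.

Lemma dicxX m i : dicx m ^+ i = cext_base (dic_data m) (cgen (2 * m) ^+ i).
Proof. by rewrite homX. Qed.

Lemma dic_relP m : dic_rel m (dicx m) (dicy m).
Proof.
by split; [rewrite dicxX -cext_genXn|rewrite [LHS]cext_gen_base homV].
Qed.

Lemma inverts_X (G : groupType) (x y : G) i :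
  y * x = x^-1 * y -> y * x ^+ i = x ^- i * y.
Proof.
move=> yx; elim: i => [|i IHi]; first by rewrite invg1 mulg1 mul1g.
by rewrite [in LHS]expgSr mulgA IHi -mulgA yx mulgA -invgM -expgS.
Qed.

Section DicRel.
Variables (m : nat) (G : groupType) (x y : G).
Hypothesis xy : dic_rel m x y.

Lemma dic_yX i : y * x ^+ i = x ^- i * y.
Proof. exact/inverts_X/xy.2. Qed.

(** All elements outside <x> have the same square; as x ^ m is that square, their
    order divides 4. *)
Lemma dic_xy2 i : (x ^+ i * y) ^+ 2 = y ^+ 2.
Proof. by rewrite !expg2 -mulgA (mulgA y) dic_yX -mulgA mulKVg. Qed.

(** Conjugation by y inverts x ^ m, yet fixes it as it is a power of y. *)
Lemma dic_x2m : x ^+ (2 * m) = 1.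
Proof.
have: y * x ^+ m = x ^+ m * y by rewrite xy.1 -expgS expgSr.
rewrite dic_yX => /mulIg e; rewrite mul2n -addnn expgnDr.
by rewrite -{1}e mulVg.
Qed.

Lemma dic_lift : 0 < m ->
  {h : {multiplicative dic m -> G} | h (dicx m) = x & h (dicy m) = y}.
Proof.
move=> m_gt0; have [|h hx] := @cyc_lift (2 * m) _ G x dic_x2m.
  by rewrite muln_gt0.
have vn : y ^+ 2 = h (top (dic_data m)) by rewrite homX hx xy.1.
have vh a : y * h a = h (tw (dic_data m) a) * y.
  by have [i ->] := cyc_form a; rewrite /= homV homX hx dic_yX.
exists (cext_lift vn vh); last exact: cext_lift_gen.
by rewrite [LHS]cext_lift_base.
Qed.

End DicRel.

Section QuaternionRelations.
Variables (G : groupType) (x y : G).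
Hypothesis xy : dic_rel 2 x y.

Lemma quat_yxy : y * x * y = x.
Proof. by rewrite xy.2 -mulgA -expg2 -xy.1 expg2 mulKg. Qed.

Lemma quat_xy : x * y = y^-1 * x.
Proof. by apply: (mulgI y); rewrite mulVKg mulgA quat_yxy. Qed.

Lemma quat_swap : dic_rel 2 y x.
Proof. by split; [rewrite xy.1|rewrite quat_xy]. Qed.

Lemma quat_rotate : dic_rel 2 y (x * y).
Proof.
split; first by have := dic_xy2 xy 1; rewrite expg1 => ->.
by rewrite [in LHS]quat_xy mulgA.
Qed.

End QuaternionRelations.

Lemma dic_form m (a : dic m) :
  exists i, a = dicx m ^+ i \/ a = dicx m ^+ i * dicy m.
Proof.
rewrite (cext_eq a); case: a => a e; have [i ->] := cyc_form a; exists i.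
rewrite /= dicxX; case: e => [[|[|//]] lt_e] /=; last by right.
by left; rewrite mulg1.
Qed.

Lemma card_dic m : 0 < m -> #|dic m| = (4 * m)%N.
Proof. by move=> m_gt0; rewrite card_cext card_cyc ?muln_gt0 // mulnAC. Qed.

Lemma dic_hom_ext m (G : groupType) (h h' : {multiplicative dic m -> G}) :
  h (dicx m) = h' (dicx m) -> h (dicy m) = h' (dicy m) -> h =1 h'.
Proof.
move=> ex ey a; have [i [] ->] := dic_form a; first by rewrite !homX ex.
by rewrite !gmulfM !homX ex ey.
Qed.

Lemma dic_generated m : [set: dic m] = <[dicx m]> <*> <[dicy m]>.
Proof.
apply/esym/cext_generated => [a|]; last by rewrite mem_gen // inE cycle_id orbT.
have [i ->] := cyc_form a; rewrite homX groupX // mem_gen //.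
by rewrite inE cycle_id.
Qed.

(** Proved for an abstract group, where evaluating the presentation does not unfold the
    concrete multiplication of [cext]. *)
Lemma dic_homgP m (gT : finGroupType) (H : {set gT}) :
  (H \homg Grp (x : y : x ^+ m = y ^+ 2, y * x * y^-1 = x^-1)) <->
  exists x y, H = <[x]> <*> <[y]> /\ dic_rel m x y.
Proof.
split=> [/existsP[[x y]] /=|[x [y [-> [e1 e2]]]]].
  rewrite !xpair_eqE /= => /and3P[/eqP <- /eqP e1 /eqP e2].
  by exists x, y; split=> //; split; rewrite // -e2 mulgVK.
by apply/existsP; exists (x, y); rewrite /= !xpair_eqE /= e1 e2 mulgK !eqxx.
Qed.

Lemma is_dicyclic_dic m : 0 < m -> is_dicyclic m (dic m).
Proof.
move=> m_gt0.
apply: (intro_isoGrp (G := [group of [set: dic m]])) => [|rT H].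
  apply/dic_homgP; exists (dicx m), (dicy m).
  by split; [exact: dic_generated|exact: dic_relP].
case/dic_homgP=> x [y [-> /dic_lift[//|h <- <-]]].
exact/homg_joing2/dic_generated.
Qed.

Lemma is_dicyclic_iso m G : 0 < m -> is_dicyclic m G -> group_iso (dic m) G.
Proof. by move=> m_gt0; apply: presented_iso; apply: is_dicyclic_dic. Qed.

(** What is used of a dicyclic group in terms of its two generators: the relations and
    the normal form x ^ i or x ^ i * y, with no overlap between the two shapes. *)
Record dic_frame m (G : finGroupType) (x y : G) : Prop := DicFrame {
  frame_rel : dic_rel m x y;
  frame_order : #[x] = (2 * m)%N;
  frame_form : forall g, exists i, g = x ^+ i \/ g = x ^+ i * y;
  frame_out : forall i, x ^+ i <> y
}.

Lemma dic_frame_dic m : 0 < m -> dic_frame m (dicx m) (dicy m).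
Proof.
move=> m_gt0; split; [exact: dic_relP| |exact: dic_form|].
- rewrite order_hom_inj; last exact: cext_base_inj.
  by rewrite order_cgen ?muln_gt0.
- by move=> i; rewrite dicxX => -[].
Qed.

Lemma dic_frame_iso m (G H : finGroupType) (f : {multiplicative G -> H}) x y :
  bijective f -> dic_frame m x y -> dic_frame m (f x) (f y).
Proof.
move=> bf [xy ox form out]; have f_inj := bij_inj bf; split.
- exact: dic_rel_hom.
- by rewrite order_hom_inj.
- case: bf => g fK gK z; have [i [] e] := form (g z); exists i.
    by left; rewrite -homX -e gK.
  by right; rewrite -homX -gmulfM -e gK.
- by move=> i; rewrite -homX => /f_inj /out.
Qed.

Lemma is_dicyclic_frame m G : 0 < m -> is_dicyclic m G ->
  exists x y : G, dic_frame m x y.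
Proof.
move=> m_gt0 /(is_dicyclic_iso m_gt0) [f bf].
by exists (f (dicx m)), (f (dicy m)); apply: dic_frame_iso (dic_frame_dic _).
Qed.

(** Generators with the relations give a surjection from the model, and the order makes
    it injective. *)
Lemma is_dicyclic_of m (G : finGroupType) (x y : G) : 0 < m ->
  dic_rel m x y -> [set: G] = <[x]> <*> <[y]> -> #|G| = (4 * m)%N ->
  is_dicyclic m G.
Proof.
move=> m_gt0 xy Gxy oG; have [h hx hy] := dic_lift xy m_gt0.
have [t bt] : group_iso (dic m) G.
  exists h; apply: surj_card_bij => [g|]; last by rewrite card_dic // oG.
  have /morphimP[z _ _ ->] : g \in hom_morphism h @* [set: dic m]; last by exists z.
  suff -> : hom_morphism h @* [set: dic m] = [set: G] by rewrite inE.
  apply/eqP; rewrite eqEsubset subsetT Gxy join_subG !cycle_subG /=.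
  by rewrite -hx -hy !(mem_morphim (hom_morphism h)) ?inE.
move=> rT H; rewrite -(is_dicyclic_dic m_gt0 H).
apply/esym/eq_homgr/isogP.
exists (hom_morphism t).
  by apply/injmP=> a b _ _; apply: bij_inj.
apply/setP=> g; rewrite -hom_image_morphim inE; case: bt => u tK uK.
by rewrite -(uK g) imset_f ?inE.
Qed.

Section Frame.
Variables (m : nat) (G : finGroupType) (x y : G).
Hypotheses (m_gt0 : 0 < m) (xy : dic_frame m x y).

Lemma frame_xX i j : (x ^+ i == x ^+ j) = (i == j %[mod 2 * m])%N.
Proof. by rewrite eq_expg_mod_order xy.(frame_order). Qed.

Lemma frame_xX1 i : (x ^+ i == 1) = (2 * m %| i)%N.
Proof. by rewrite -order_dvdn xy.(frame_order). Qed.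

Lemma frame_y4 : y ^+ 4 = 1.
Proof.
by rewrite (expgnA y 2 2) -xy.(frame_rel).1 -expgnA mulnC (dic_x2m xy.(frame_rel)).
Qed.

Lemma frame_xy4 i : (x ^+ i * y) ^+ 4 = 1.
Proof. by rewrite (expgnA _ 2 2) (dic_xy2 xy.(frame_rel)) -expgnA frame_y4. Qed.

Lemma frame_y2_neq1 : y ^+ 2 <> 1.
Proof.
rewrite -xy.(frame_rel).1 => /eqP; rewrite frame_xX1 => /(dvdn_leq m_gt0).
by rewrite leqNgt ltn_Pmull.
Qed.

(** A dicyclic group has one involution: elements outside <x> have order 4, and the
    cyclic group <x> has one involution. *)
Lemma frame_involution w : w ^+ 2 = 1 -> w <> 1 -> w = x ^+ m.
Proof.
have [i [] ->] := xy.(frame_form) w; last first.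
  by rewrite (dic_xy2 xy.(frame_rel)) => /frame_y2_neq1.
rewrite -expgnA => /eqP; rewrite frame_xX1 [(i * 2)%N]mulnC dvdn_pmul2l //.
case/dvdnP=> j ->.
rewrite mulnC expgnA; have -> : x ^+ m ^+ j = x ^+ m ^+ odd j.
  rewrite -{1}(odd_double_half j) expgnDr -mul2n expgnA -[_ ^+ 2]expgnA.
  by rewrite [(m * 2)%N]mulnC (dic_x2m xy.(frame_rel)) expg1n mulg1.
by case: odd.
Qed.

End Frame.

(** * Cyclic amalgamated subgroup *)

(** A cyclic group over its subgroup of index 2: v is central and v ^ 2 is the
    generator. *)
Definition cyc_data q : cext_data (cyc (2 * q)) 2 :=
  @CextData _ 2 idfun (cgen (2 * q)) erefl (fun a => cyc_commute a _).

Lemma is_cyclic_cext q : 0 < q -> is_cyclic (4 * q) (cext (cyc_data q)).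
Proof.
move=> q_gt0; split; last by rewrite card_cext card_cyc ?muln_gt0 // mulnAC.
apply/cyclicP; exists (cext_gen (cyc_data q)).
apply/esym/cext_generated => [a|]; last exact: cycle_id.
have [i ->] := cyc_form a; rewrite homX groupX //.
by rewrite -(cext_genXn (cyc_data q)) mem_cycle.
Qed.

Lemma cgen_nonsquare q a : 0 < q -> a ^+ 2 <> cgen (2 * q).
Proof.
move=> q_gt0; have [i ->] := cyc_form a; rewrite -expgnA => /eqP.
rewrite -[X in _ == X]expg1 eq_expg_mod_order order_cgen ?muln_gt0 //.
move/eqP/(congr1 (modn^~ 2)); rewrite !modn_dvdm ?dvdn_mulr //.
by rewrite modnMl.
Qed.

(** The image of the generator c has order 2q in a cyclic group of order 4q, so it is a
    square; its root is not in f(F) as c has no root in F. *)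
Lemma cyclic_realizes q (G : finGroupType) (f : {multiplicative cyc (2 * q) -> G}) :
  0 < q -> is_cyclic (4 * q) G -> index2_embedding f -> realizes (cyc_data q) f.
Proof.
move=> q_gt0 [/cyclicP[u Gu] oG] [f_inj _].
have form g : exists i, g = u ^+ i by apply/cycleP; rewrite -Gu inE.
have [j fj] := form (f (cgen (2 * q))).
have ou : #[u] = (4 * q)%N by rewrite orderE -Gu cardsT.
have /dvdnP[l jl] : 2 %| j.
  rewrite -(@dvdn_pmul2r (2 * q)) ?muln_gt0 // mulnA -ou order_dvdn expgnA -fj.
  by rewrite -homX cgenX hom1.
exists (u ^+ l); split.
- move=> a fa; apply: (@cgen_nonsquare q a) => //; apply: f_inj.
  by rewrite homX fa -expgnA -jl.
- by rewrite -expgnA -jl -fj.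
- by move=> a; have [i ->] := form (f a); rewrite /= -!expgnDr addnC.
Qed.

(** If f(F) = <x>, take v = y. Otherwise a generator of f(F) lies outside <x>, so its
    order 2q is 4; the group is Q8, and v = x inverts every cyclic subgroup of order 4
    other than <x>. In both cases v ^ 2 is the unique involution, hence the image of the
    involution of F. *)
Lemma dicyclic_realizes q (G : finGroupType) (f : {multiplicative cyc (2 * q) -> G}) :
  1 < q -> is_dicyclic q G -> index2_embedding f -> realizes (dic_data q) f.
Proof.
move=> q_gt1 dG [f_inj _]; have q_gt0 := ltnW q_gt1.
have [x [y xy]] := is_dicyclic_frame q_gt0 dG.
pose g := cgen (2 * q); have og : #[g] = (2 * q)%N by rewrite order_cgen ?muln_gt0.
(* both sides are the unique involution *)
have fz : f (g ^+ q) = x ^+ q.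
  apply: (frame_involution q_gt0 xy).
    by rewrite -homX -expgnA [(q * 2)%N]mulnC cgenX hom1.
  rewrite -(hom1 f) => /f_inj /eqP; rewrite -order_dvdn og => /(dvdn_leq q_gt0).
  by rewrite leqNgt ltn_Pmull.
have conj v : v * f g = f g^-1 * v -> forall a, v * f a = f (tw (dic_data q) a) * v.
  move=> vg a; have [i ->] := cyc_form a; rewrite /= homV !homX.
  by apply: inverts_X; rewrite -homV.
have [j [] fj] := xy.(frame_form) (f g).
  exists y; split.
  - move=> a; have [i ->] := cyc_form a; rewrite homX fj -expgnA.
    exact: xy.(frame_out).
  - by rewrite -xy.(frame_rel).1 -fz.
  - by apply: conj; rewrite homV fj (dic_yX xy.(frame_rel)).
have q2 : q = 2.
  have /eqP : f (g ^+ 4) = f 1 by rewrite homX fj (frame_xy4 xy) hom1.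
  rewrite (inj_eq f_inj) -order_dvdn og => /(@dvdn_leq _ 4 isT).
  by rewrite (@leq_pmul2l 2 q 2) // => le_q2; apply/anti_leq; rewrite le_q2.
subst q; exists x; split.
- move=> a xa; have : commute x (f g).
    by rewrite -xa /commute -!gmulfM cyc_commute.
  rewrite /commute fj mulgA -expgS -mulgA xy.(frame_rel).2.
  rewrite mulgA => /mulIg; rewrite expgSr.
  move/mulgI/(congr1 (mul x)); rewrite mulgV -expg2 => /eqP.
  by rewrite (frame_xX1 xy).
- by rewrite fz.
- apply: conj; rewrite homV fj; apply: (mulgI (x ^+ j * y)); rewrite mulVKg.
  rewrite (mulgA x) -expgS -mulgA (mulgA y) (dic_yX xy.(frame_rel)) -mulgA.
  rewrite -expg2 -xy.(frame_rel).1 [x ^+ j.+1]expgS invgM -(mulgA _ x^-1).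
  by rewrite mulVKg expg2 mulKg.
Qed.

(** * Dicyclic amalgamated subgroup *)

(** If v ^ 2 is the commutator of v and y, then y inverts v: this is how the adjoined
    square root of X becomes the long generator of a dicyclic group. *)
Lemma square_inverts (G : groupType) (v y : G) :
  v * y = v ^+ 2 * y * v -> y * v = v^-1 * y.
Proof. by rewrite expg2 -!mulgA => /mulgI e; rewrite [in RHS]e mulKg. Qed.

Lemma half_twist_square (G : groupType) (x y : G) i :
  y * x = x^-1 * y -> x ^+ i * (x * (x * y)) * x = x * (x ^+ i * y).
Proof. by move=> yx; rewrite -!mulgA yx mulVKg !mulgA -expgSr -expgS. Qed.

Section HalfData.
Variables (m : nat) (m_gt0 : 0 < m).
Local Notation X := (dicx m).
Local Notation Y := (dicy m).

Fact half_rel : dic_rel m X (X * Y).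
Proof.
have [XY1 XY2] := dic_relP m; split.
  by rewrite -{2}[X]expg1 (dic_xy2 (dic_relP m)).
by rewrite -mulgA XY2 mulgA mulgV mul1g mulKg.
Qed.

(** Conjugation by a square root of X in the dicyclic group of twice the order. *)
Definition half_twist : {multiplicative dic m -> dic m} :=
  sval (sig_of_sig2 (dic_lift half_rel m_gt0)).

Lemma half_twist_x : half_twist X = X.
Proof. by rewrite /half_twist; case: dic_lift. Qed.

Lemma half_twist_y : half_twist Y = X * Y.
Proof. by rewrite /half_twist; case: dic_lift. Qed.

Fact half_twist_iter a : half_twist (half_twist a) * X = X * a.
Proof.
have [i [] ->] := dic_form a.
  by rewrite !homX !half_twist_x -expgSr expgS.
rewrite !gmulfM !homX !half_twist_x half_twist_y gmulfM half_twist_x half_twist_y.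
exact/half_twist_square/(dic_relP m).2.
Qed.

Definition half_data : cext_data (dic m) 2 :=
  @CextData _ 2 half_twist X half_twist_x half_twist_iter.

Lemma is_dicyclic_cext : is_dicyclic (2 * m) (cext half_data).
Proof.
pose b := cext_base half_data; pose v := cext_gen half_data.
have v2 : v ^+ 2 = b X by exact: cext_genXn.
have vY : v * b Y = b X * b Y * v.
  by rewrite -gmulfM -half_twist_y; apply: cext_gen_base.
apply: (@is_dicyclic_of _ _ v (b Y)).
- by rewrite muln_gt0.
- split; first by rewrite expgnA v2 -[LHS]homX (dic_relP m).1 homX.
  by apply: square_inverts; rewrite v2 vY.
- apply/esym/cext_generated => [a|]; last by rewrite mem_gen // inE cycle_id.
  have bX : b X \in <[v]> <*> <[b Y]>.
    by rewrite -v2 groupX // mem_gen // inE cycle_id.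
  have bY : b Y \in <[v]> <*> <[b Y]> by rewrite mem_gen // inE cycle_id orbT.
  by have [i [] ->] := dic_form a; rewrite ?gmulfM homX ?groupM ?groupX.
- by rewrite card_cext card_dic // mulnC mulnCA.
Qed.

End HalfData.

(** A root of X would be a power of X, which is impossible modulo the even number 2m, or
    have square X ^ m, which differs from X. *)
Lemma dicx_nonsquare m a : 1 < m -> a ^+ 2 <> dicx m.
Proof.
move=> m_gt1; have m_gt0 := ltnW m_gt1; have fr := dic_frame_dic m_gt0.
have [i [] ->] := dic_form a.
  rewrite -expgnA => /eqP; rewrite -[X in _ == X]expg1 (frame_xX fr).
  move/eqP/(congr1 (modn^~ 2)); rewrite !modn_dvdm ?dvdn_mulr //.
  by rewrite modnMl.
rewrite (dic_xy2 (dic_relP m)) -(dic_relP m).1 => /eqP.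
rewrite -[X in _ == X]expg1 (frame_xX fr) !modn_small ?ltn_Pmull //.
  by rewrite gtn_eqF.
by rewrite (leq_trans m_gt1) ?leq_pmull.
Qed.

(** Since f(X) is killed by 2m, its exponent j modulo 4m is even, and x ^ (j / 2) is the
    element v. The image of Y is outside <x> because it does not commute with f(X). *)
Lemma half_realizes m (m_gt0 : 0 < m) (G : finGroupType) (x y : G) j
    (f : {multiplicative dic m -> G}) :
  1 < m -> dic_frame (2 * m) x y -> injective f -> f (dicx m) = x ^+ j ->
  realizes (half_data m_gt0) f.
Proof.
move=> m_gt1 xy f_inj fX; have m2_gt0 : 0 < 2 * m by rewrite muln_gt0.
have frX := dic_frame_dic m_gt0.
have /dvdnP[l jl] : 2 %| j.
  rewrite -(@dvdn_pmul2r (2 * m)) // -(frame_xX1 xy) expgnA -fX -homX.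
  by rewrite (dic_x2m (dic_relP m)) hom1.
have v2 : x ^+ l ^+ 2 = f (dicx m) by rewrite -expgnA -jl fX.
have [i fY] : exists i, f (dicy m) = x ^+ i * y.
  have [i [] fY] := xy.(frame_form) (f (dicy m)); last by exists i.
  have : f (dicy m * dicx m) = f (dicx m * dicy m).
    by rewrite !gmulfM fX fY -!expgnDr addnC.
  move/f_inj; rewrite (dic_relP m).2 => /mulIg /(congr1 (mul (dicx m))).
  rewrite mulgV -expg2 => /esym /eqP; rewrite (frame_xX1 frX) => /(@dvdn_leq _ 2 isT).
  by rewrite -{2}[2]muln1 leq_pmul2l // leqNgt m_gt1.
exists (x ^+ l); split=> [a fa||a].
- by apply: (@dicx_nonsquare m a m_gt1); apply: f_inj; rewrite homX fa.
- by rewrite v2.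
have vY : x ^+ l * f (dicy m) = f (dicx m * dicy m) * x ^+ l.
  rewrite gmulfM fY -v2 -!mulgA (dic_yX xy.(frame_rel)); congr mul.
  by rewrite !mulgA -!expgnDr [(l + i)%N]addnC expgnDr mulgK.
have vX n : x ^+ l * f (dicx m) ^+ n = f (dicx m) ^+ n * x ^+ l.
  by rewrite fX -expgnA -!expgnDr addnC.
change (tw (half_data m_gt0) a) with (half_twist m_gt0 a).
have [n [] ->] := dic_form a; first by rewrite !homX half_twist_x vX.
rewrite !gmulfM !homX half_twist_x half_twist_y.
by rewrite mulgA vX -mulgA vY -mulgA.
Qed.

(** Elements outside <x> have order 4, while X has order 2m > 4. *)
Lemma half_realizes_large m (m_gt0 : 0 < m) (G : finGroupType)
    (f : {multiplicative dic m -> G}) :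
  2 < m -> is_dicyclic (2 * m) G -> index2_embedding f -> realizes (half_data m_gt0) f.
Proof.
move=> m_gt2 dG [f_inj _]; have m2_gt0 : 0 < 2 * m by rewrite muln_gt0.
have [x [y xy]] := is_dicyclic_frame m2_gt0 dG.
have [j [fX|fX]] := xy.(frame_form) (f (dicx m)).
  exact: half_realizes (ltnW m_gt2) xy f_inj fX.
have /f_inj/eqP : f (dicx m ^+ 4) = f 1 by rewrite homX fX (frame_xy4 xy) hom1.
rewrite (frame_xX1 (dic_frame_dic m_gt0)) => /(@dvdn_leq _ 4 isT).
by rewrite (@leq_pmul2l 2 m 2) // leqNgt m_gt2.
Qed.

(** * The two amalgams over the quaternion group *)

Section Q16Amalgams.

Local Notation X := (dicx 2).
Local Notation Y := (dicy 2).

Definition swap : {multiplicative dic 2 -> dic 2} :=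
  sval (sig_of_sig2 (dic_lift (quat_swap (dic_relP 2)) isT)).

Lemma swap_x : swap X = Y. Proof. by rewrite /swap; case: dic_lift. Qed.
Lemma swap_y : swap Y = X. Proof. by rewrite /swap; case: dic_lift. Qed.

Lemma swapK : involutive swap.
Proof.
apply: (dic_hom_ext (h := swap \o swap) (h' := idfun)) => /=.
  by rewrite swap_x swap_y.
by rewrite swap_y swap_x.
Qed.

Local Notation D := (half_data (isT : 0 < 2)).
Local Notation base := (cext_base D).
Local Notation twist := (half_twist (isT : 0 < 2)).
Local Notation v := (cext_gen D).

(** The square of tw is an inner automorphism. *)
Lemma tw_bij (F : finGroupType) (D' : cext_data F 2) : bijective (tw D').
Proof.
apply: injF_bij => a b e; apply: (@mulgI _ (top D')).
by rewrite -!tw_iter /= e.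
Qed.

Lemma quaternion_realizes (G : finGroupType) (x y : G)
    (f : {multiplicative dic 2 -> G}) :
  dic_frame 4 x y -> injective f -> f X \in <[x]> -> realizes D f.
Proof. by move=> xy f_inj /cycleP[j fX]; exact: (@half_realizes 2 _ G x y j). Qed.

(** Modulo <x>, the image of X * Y is the product of two elements of a group of order 2. *)
Lemma quaternion_types (G : finGroupType) (x y : G)
    (f : {multiplicative dic 2 -> G}) : dic_frame 4 x y ->
  [\/ (f X \in <[x]>), (f Y \in <[x]>) | (f (X * Y) \in <[x]>)].
Proof.
move=> xy; rewrite gmulfM.
have [i [fX|fX]] := xy.(frame_form) (f X).
  by constructor 1; rewrite fX mem_cycle.
have [j [fY|fY]] := xy.(frame_form) (f Y).
  by constructor 2; rewrite fY mem_cycle.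
constructor 3; rewrite fX fY -mulgA (mulgA y) (dic_yX xy.(frame_rel)) -mulgA.
rewrite -expg2 -xy.(frame_rel).1 groupM ?mem_cycle //.
by rewrite groupM ?groupV ?mem_cycle.
Qed.

(** The isomorphism invariant that separates the two amalgams of Q16: the homomorphisms
    to the group of order 2 form a space of rank at most 2. *)
Definition two_determined (P : groupType) := exists p1 p2 : P,
  forall h h' : {multiplicative P -> cyc 2}, h p1 = h' p1 -> h p2 = h' p2 -> h =1 h'.

Lemma two_determined_iso (P P' : groupType) :
  group_iso P P' -> two_determined P -> two_determined P'.
Proof.
move=> [f [g fK gK]] [p1 [p2 det]]; exists (f p1), (f p2) => h h' e1 e2 p.
by rewrite -(gK p); apply: (det (h \o f) (h' \o f)).
Qed.

(** The subgroup Q8 is generated by the squares of the two adjoined elements, so these two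
    elements generate the amalgam. *)
Lemma twisted_two_determined (P : groupType)
    (i1 i2 : {multiplicative cext D -> P}) :
  is_pushout base (base \o swap) i1 i2 -> two_determined P.
Proof.
move=> pP; exists (i1 v), (i2 v) => h h' e1 e2.
have vX : base X = v ^+ 2 by rewrite cext_genXn.
have eX : h (i1 (base X)) = h' (i1 (base X)) by rewrite vX !homX e1.
have eX2 : h (i2 (base X)) = h' (i2 (base X)) by rewrite vX !homX e2.
have iY : i1 (base Y) = i2 (base X) by have /= := pP.1 Y; rewrite swap_y.
have iX : i2 (base Y) = i1 (base X) by have /= := pP.1 X; rewrite swap_x.
apply: (pushout_hom_ext pP).
- apply: (cext_hom_ext (h := h \o i1) (h' := h' \o i1)) => //.
  by apply: (dic_hom_ext (h := h \o i1 \o base) (h' := h' \o i1 \o base)); rewrite //= iY.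
- apply: (cext_hom_ext (h := h \o i2) (h' := h' \o i2)) => //.
  by apply: (dic_hom_ext (h := h \o i2 \o base) (h' := h' \o i2 \o base)); rewrite //= iX.
Qed.

Local Notation u := (cgen 2).

Lemma cgen2_bool_inj (a b : bool) : u ^+ a = u ^+ b -> a = b.
Proof. by move/eqP; rewrite eq_expg_mod_order order_cgen //; case: a b => [] []. Qed.

(** X is a square and a commutator in Q16, but the values at v and at Y are free. *)
Lemma hom_to_order2 (a b : bool) :
  exists h : {multiplicative cext D -> cyc 2},
    [/\ h v = u ^+ a, h (base X) = 1 & h (base Y) = u ^+ b].
Proof.
have u2 (e : bool) : u ^+ e ^+ 2 = 1 by rewrite -expgnA mulnC expgnA cgenX expg1n.
have rel : dic_rel 2 (1 : cyc 2) (u ^+ b).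
  by split; rewrite ?u2 ?expg1n // invg1 mulg1 mul1g.
have [h hX hY] := dic_lift rel isT.
have vn : u ^+ a ^+ 2 = h (top D) by rewrite u2 hX.
have hD z : h (tw D z) = h z.
  apply: (dic_hom_ext (h := h \o twist) (h' := h)) => /=.
    by rewrite half_twist_x.
  by rewrite half_twist_y gmulfM hX mul1g.
have vh z : u ^+ a * h z = h (tw D z) * u ^+ a by rewrite hD cyc_commute.
exists (cext_lift vn vh); split; first exact: cext_lift_gen.
  by rewrite -hX; apply: cext_lift_base.
by rewrite -hY; apply: cext_lift_base.
Qed.

(** The values at the two adjoined elements and at Y can be chosen independently, which
    gives 8 homomorphisms, whereas two elements would distinguish at most 4. *)
Lemma untwisted_not_two_determined (P : groupType)
    (i1 i2 : {multiplicative cext D -> P}) :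
  is_pushout base (base \o idfun) i1 i2 -> ~ two_determined P.
Proof.
move=> pP [p1 [p2 det]].
have homs (c : bool * bool * bool) : exists h : {multiplicative P -> cyc 2},
    [/\ h (i1 v) = u ^+ c.1.1, h (i2 v) = u ^+ c.1.2 & h (i1 (base Y)) = u ^+ c.2].
  have [h1 [h1v h1X h1Y]] := hom_to_order2 c.1.1 c.2.
  have [h2 [h2v h2X h2Y]] := hom_to_order2 c.1.2 c.2.
  have [|h [he1 he2] _] := pP.2 _ h1 h2.
    by apply: (dic_hom_ext (h := h1 \o base) (h' := h2 \o base)); rewrite /= ?h1X ?h1Y.
  by exists h; split; rewrite ?[h (i1 _)]he1 ?[h (i2 _)]he2.
have [h hP] := choice homs.
have inj : injective (fun c => (h c p1, h c p2)).
  move=> [[a a'] b] [[c c'] d] [e1 e2]; have e := det _ _ e1 e2.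
  have [/= q1 q2 q3] := hP (a, a', b); have [/= r1 r2 r3] := hP (c, c', d).
  rewrite !e in q1 q2 q3.
  by rewrite (cgen2_bool_inj (etrans (esym q1) r1))
    (cgen2_bool_inj (etrans (esym q2) r2)) (cgen2_bool_inj (etrans (esym q3) r3)).
have := leq_card _ inj; rewrite (card_prod (cyc 2) (cyc 2)) card_cyc //.
by rewrite !card_prod !card_bool.
Qed.

Definition q16_amalgam (s : {multiplicative dic 2 -> dic 2}) : groupType :=
  amalgam base (base \o s).

Lemma q16_amalgam_form (s : {multiplicative dic 2 -> dic 2}) : bijective s ->
  amalgam_form (is_dicyclic 4) (is_dicyclic 2) (is_dicyclic 4) (q16_amalgam s).
Proof.
move=> bs; exists (cext D), (dic 2), (cext D), base, (base \o s).
exists (amalgam_inl base (base \o s)), (amalgam_inr base (base \o s)); split.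
- by split; [exact: is_dicyclic_cext|exact: is_dicyclic_dic|exact: is_dicyclic_cext].
- exact: cext_base_index2.
- by apply: index2_embedding_comp => //; apply: cext_base_index2.
- exact: amalgam_pushout.
Qed.

(** The automorphism c normalizes the first embedding. It may still be changed by [twist],
    which fixes X and sends Y to X * Y; this identifies the case where the second
    embedding singles out X * Y with the case where it singles out Y. *)
Lemma q16_amalgam_classes P :
  amalgam_form (is_dicyclic 4) (is_dicyclic 2) (is_dicyclic 4) P ->
  group_iso P (q16_amalgam idfun) \/ group_iso P (q16_amalgam swap).
Proof.
case=> [G1 [F [G2 [f1 [f2 [i1 [i2 [[dG1 dF dG2] if1 if2 pP]]]]]]]].
have [c0 bc0] := is_dicyclic_iso (isT : 0 < 2) dF.
have [x1 [y1 xy1]] := is_dicyclic_frame (isT : 0 < 4) dG1.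
have [x2 [y2 xy2]] := is_dicyclic_frame (isT : 0 < 4) dG2.
have bswap : bijective swap := inv_bij swapK.
have btwist : bijective twist := tw_bij D.
have [c bc cX] : exists2 c : {multiplicative dic 2 -> F},
    bijective c & f1 (c X) \in <[x1]>.
  have [e|e|e] := quaternion_types (f1 \o c0) xy1.
  - by exists c0.
  - by exists (c0 \o swap); rewrite /= ?swap_x //; apply: bij_comp.
  - exists (c0 \o (twist \o swap)); last by rewrite /= swap_x half_twist_y.
    by do 2!apply: bij_comp => //.
(* s = swap is needed exactly when the two embeddings single out different units *)
suff main (c' : {multiplicative dic 2 -> F}) (s : {multiplicative dic 2 -> dic 2}) :
    bijective c' -> involutive s -> f1 (c' X) \in <[x1]> ->
    f2 (c' (s X)) \in <[x2]> -> group_iso P (q16_amalgam s).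
  have [e|e|e] := quaternion_types (f2 \o c) xy2.
  - by left; apply: (main c).
  - by right; apply: (main c) => //; [exact: swapK|rewrite swap_x].
  - right; apply: (main (c \o twist)); [exact: bij_comp|exact: swapK| |].
      by rewrite /= half_twist_x.
    by rewrite /= swap_x half_twist_y.
move=> bc' sK c1 c2.
have r1 := quaternion_realizes xy1 (inj_comp if1.1 (bij_inj bc')) c1.
have r2 := quaternion_realizes (f := f2 \o c' \o s) xy2
  (inj_comp (inj_comp if2.1 (bij_inj bc')) (inv_inj sK)) c2.
have [j1 [j2 pj]] := pushout_model bc' sK if1 if2 r1 r2 pP.
exact: pushout_unique pj (amalgam_pushout _ _).
Qed.

Lemma q16_two_classes : exactly_iso_classes 2
  (amalgam_form (is_dicyclic 4) (is_dicyclic 2) (is_dicyclic 4)).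
Proof.
pose s (i : 'I_2) := if i == ord0 then q16_amalgam idfun else q16_amalgam swap.
have det := twisted_two_determined (amalgam_pushout base (base \o swap)).
have ndet := untwisted_not_two_determined (amalgam_pushout base (base \o idfun)).
exists s; split.
- move=> i; rewrite /s; case: ifP => _; apply: q16_amalgam_form; first by exists idfun.
  exact: inv_bij swapK.
- move=> i j; rewrite /s; case: eqP => [->|ni0]; case: eqP => [->|nj0] //.
  + by move/group_iso_sym/two_determined_iso => /(_ det).
  + by move/two_determined_iso => /(_ det).
  + move=> _; suff max (k : 'I_2) : k <> ord0 -> k = ord_max.
      by rewrite (max i ni0) (max j nj0).
    by case: k => [[|[|//]] ltk] k0; [case: k0|]; apply: val_inj.
- move=> P /q16_amalgam_classes[e|e]; first by exists ord0.
  by exists ord_max.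
Qed.

End Q16Amalgams.

(** * The binary tetrahedral group *)

Lemma expg3 (G : groupType) (a : G) : a ^+ 3 = a * a * a.
Proof. exact: mulgA. Qed.

(** The symmetric form x ^ 2 = y ^ 2 = (x y) ^ 2 of the quaternion relations. *)
Lemma quaternion_rel (G : groupType) (x y : G) :
  x ^+ 2 = y ^+ 2 -> (x * y) ^+ 2 = x ^+ 2 -> dic_rel 2 x y.
Proof.
move=> exy; rewrite [in LHS]expg2 [in RHS]expg2 -mulgA => /mulgI e; split=> //.
have -> : y * x = x * y^-1 by apply: (mulIg y); rewrite mulgVK -mulgA e.
by apply: (mulgI x); rewrite mulVKg mulgA -expg2 exy expg2 mulgK.
Qed.

(** T* as Q8 extended by an element of order 3 that permutes x, y, xy cyclically. *)
Definition tet_rel (G : groupType) (x y u : G) :=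
  [/\ dic_rel 2 x y, u ^+ 3 = 1, u * x = y * u & u * y = x * y * u].

(** Elements conjugate by g have the same n-th power if that power commutes with g. *)
Lemma conj_pow (G : groupType) (a b g z : G) n :
  commute z g -> a * g = g * b -> a ^+ n = z -> b ^+ n = z.
Proof.
move=> zg ag an; apply: (mulgI g); rewrite -zg -{}an.
elim: n => [|n IHn]; first by rewrite mulg1 mul1g.
by rewrite !expgS -mulgA -IHn !mulgA ag.
Qed.

(** The common part of the passage from the presentations of T* and O* to Q8 and an
    element of order 3: s has order 6, z = s ^ 3 is the central involution, u = s z has
    order 3, and x, s x s^-1 and s ^ 2 x s^-2 are the three quaternion units. *)
Lemma tet_rel_of_cube (G : groupType) (s x : G) (z := s ^+ 3) :
    commute z x -> z * z = 1 -> x ^+ 2 = z ->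
    x * (s * x * s^-1) = s * (s * x * s^-1) * s^-1 ->
  tet_rel x (s * x * s^-1) (s * z).
Proof.
set y := s * x * s^-1 => zx z2 x2 xy; have cs : commute z s by exact/commute_sym/commuteX.
have conj2 a : a ^+ 2 = z -> (s * a * s^-1) ^+ 2 = z.
  move=> a2; apply: (@conj_pow _ a _ s^-1) => //; last by rewrite !mulgA mulVg mul1g.
  exact: commuteV.
have y2 : y ^+ 2 = z by exact: conj2.
have zy : commute z y by do 2?apply: commuteM => //; apply: commuteV.
split.
- by apply: quaternion_rel; rewrite ?xy ?x2 ?y2 //; apply: conj2.
- rewrite expgMn; last exact: commute_sym.
  by rewrite -/z -[LHS](expgS z 3) (expgnA z 2 2) (z2 : z ^+ 2 = 1) expg1n.
- have sx : s * x = y * s by rewrite /y mulgVK.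
  by rewrite -(mulgA s z x) zx (mulgA s x z) sx -(mulgA y).
- have sy : s * y = s * y * s^-1 * s by rewrite mulgVK.
  by rewrite xy -(mulgA s z y) zy (mulgA s y z) {1}sy -(mulgA _ s z).
Qed.

Section PolyhedralRelations.
Variables (G : groupType) (s t : G).
Hypothesis e1 : t * s * t = s * s.
Let z := s ^+ 3.

Fact poly_ts : t * s = s * s * t^-1. Proof. by rewrite -e1 mulgK. Qed.

Fact poly_cs : commute z s. Proof. exact/commute_sym/commuteX. Qed.

Section Tetrahedral.
Hypothesis e2 : s * t * s = t * t.

Fact tet_zt : z = t ^+ 3.
Proof. by rewrite /z !expg3 -e1 -!mulgA (mulgA s t s) e2. Qed.

Fact tet_ct : commute z t.
Proof. rewrite tet_zt; exact/commute_sym/commuteX. Qed.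

(** The relations make s conjugate to t^-1. Cubing, z = s ^ 3 is conjugate to
    t ^ -3 = z^-1, and z is central. *)
Fact tet_z2 : z * z = 1.
Proof.
suff e : t^-1 ^+ 3 = z by rewrite -{1}e expVgn -tet_zt mulVg.
apply: (@conj_pow _ s _ (t^-1 * s)) => //.
  by apply: commuteM; [apply: commuteV; exact: tet_ct|exact: poly_cs].
have tV2 : t^-1 * t^-1 = s^-1 * t^-1 * s^-1 by rewrite -!invgM -e2 !mulgA.
apply: (mulgI t); rewrite !mulgA poly_ts -(mulgA _ t^-1 t^-1) tV2.
by rewrite !gnorm.
Qed.

Lemma tet_rel_presented : tet_rel (s * t) (s * (s * t) * s^-1) (s * z).
Proof.
apply: tet_rel_of_cube; first by apply: commuteM; [exact: poly_cs|exact: tet_ct].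
- exact: tet_z2.
- by rewrite expg2 -mulgA (mulgA t) e1 /z expg3 mulgA.
apply: (mulIg (s * s)); rewrite !mulgA !mulgVK.
rewrite e2 -!(mulgA (t * t)) e2 -expg3 -/z tet_zt expg3.
by rewrite !mulgA.
Qed.
End Tetrahedral.
End PolyhedralRelations.

Section Rotation.
Local Notation X := (dicx 2).
Local Notation Y := (dicy 2).

Definition rotate : {multiplicative dic 2 -> dic 2} :=
  sval (sig_of_sig2 (dic_lift (quat_rotate (dic_relP 2)) isT)).

Lemma rotate_x : rotate X = Y. Proof. by rewrite /rotate; case: dic_lift. Qed.
Lemma rotate_y : rotate Y = X * Y. Proof. by rewrite /rotate; case: dic_lift. Qed.

Lemma rotate_xy : rotate (X * Y) = X.
Proof. by rewrite gmulfM rotate_x rotate_y mulgA (quat_yxy (dic_relP 2)). Qed.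

Fact rotate_iter a : iter 3 rotate a * 1 = 1 * a.
Proof.
rewrite mulg1 mul1g.
apply: (dic_hom_ext (h := rotate \o rotate \o rotate) (h' := idfun)) => /=.
  by rewrite rotate_x rotate_y rotate_xy.
by rewrite rotate_y rotate_xy rotate_x.
Qed.

Definition tet_data : cext_data (dic 2) 3 :=
  @CextData _ 3 rotate 1 (hom1 rotate) rotate_iter.

End Rotation.

Definition tet : finGroupType := cext tet_data.
Definition tetx : tet := cext_base tet_data (dicx 2).
Definition tety : tet := cext_base tet_data (dicy 2).
Definition tetu : tet := cext_gen tet_data.

Lemma tet_relP : tet_rel tetx tety tetu.
Proof.
split.
- exact/dic_rel_hom/dic_relP.
- by rewrite cext_genXn hom1.
- by rewrite [LHS]cext_gen_base rotate_x.
- by rewrite [LHS]cext_gen_base rotate_y gmulfM.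
Qed.

Lemma tet_lift (G : groupType) (x y u : G) : tet_rel x y u ->
  {h : {multiplicative tet -> G} | [/\ h tetx = x, h tety = y & h tetu = u]}.
Proof.
move=> [xy u3 ux uy]; have [h hx hy] := dic_lift xy isT.
have un : u ^+ 3 = h (top tet_data) by rewrite hom1.
have uh a : u * h a = h (tw tet_data a) * u.
  pose c := mkhom (fun a b => conjMg a b u^-1).
  have cE b : c b = u * b * u^-1 by rewrite /= conjgE invgK mulgA.
  suff e : c (h a) = h (tw tet_data a) by rewrite -e cE mulgVK.
  apply: (dic_hom_ext (h := c \o h) (h' := h \o rotate)) a.
    by rewrite [LHS]cE [RHS]/= rotate_x hx hy ux mulgK.
  by rewrite [LHS]cE [RHS]/= rotate_y gmulfM hx hy uy mulgK.
exists (cext_lift un uh); split; last exact: cext_lift_gen.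
  by rewrite -hx; apply: cext_lift_base.
by rewrite -hy; apply: cext_lift_base.
Qed.

Lemma tet_hom_ext (G : groupType) (h h' : {multiplicative tet -> G}) :
  h tetx = h' tetx -> h tety = h' tety -> h tetu = h' tetu -> h =1 h'.
Proof.
move=> ex ey eu; apply: cext_hom_ext => //.
exact: (dic_hom_ext (h := h \o cext_base tet_data) (h' := h' \o cext_base tet_data)).
Qed.

Lemma tet_generated (A : {group tet}) :
  tetx \in A -> tety \in A -> tetu \in A -> A = [set: tet] :> {set tet}.
Proof.
move=> Ax Ay Au; apply: cext_generated => // a.
by have [i [] ->] := dic_form a; rewrite ?gmulfM homX ?groupM ?groupX.
Qed.

Section TetRelTheory.
Variables (G : groupType) (x y u : G).
Hypothesis xyu : tet_rel x y u.

Let xy : dic_rel 2 x y. Proof. by case: xyu. Qed.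
Let u3 : u ^+ 3 = 1. Proof. by case: xyu. Qed.
Let ux : u * x = y * u. Proof. by case: xyu. Qed.
Let uy : u * y = x * y * u. Proof. by case: xyu. Qed.

Lemma tet_uxy : u * (x * y) = x * u.
Proof. by rewrite mulgA ux -mulgA uy mulgA mulgA (quat_yxy xy). Qed.

Lemma tet_x4 : x ^+ 4 = 1. Proof. exact: (dic_x2m xy). Qed.

Lemma tet_x2C : [/\ commute (x ^+ 2) x, commute (x ^+ 2) y & commute (x ^+ 2) u].
Proof.
have cx : commute (x ^+ 2) x by exact/commute_sym/commuteX.
have cy : commute (x ^+ 2) y by rewrite xy.1; apply/commute_sym/commuteX.
split=> //; apply: commute_sym; rewrite /commute expg2.
by rewrite mulgA ux -mulgA ux mulgA -!expg2 xy.1.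
Qed.

Lemma tet_uV : [/\ u^-1 * y = x * u^-1, u^-1 * x = x * y * u^-1 & u * u = u^-1].
Proof.
split; first by apply: (mulgI u); rewrite mulVKg mulgA ux mulgK.
  by apply: (mulgI u); rewrite mulVKg mulgA tet_uxy mulgK.
by apply/esym/mulg1_eq; rewrite mulgA -expg3.
Qed.

(** Conjugation by the adjoined element of O* exchanges x and y and sends u to x u^-1;
    the lemma says that this preserves the relations of T*. *)
Lemma tet_flip : tet_rel y x (x * u^-1).
Proof.
have [uVy uVx uu] := tet_uV; have [cx cy cu] := tet_x2C; split.
- exact: quat_swap.
- rewrite expg3 -!mulgA (mulgA u^-1 x) uVx -!mulgA (mulgA u^-1 u^-1) -invgM uu invgK.
  rewrite (mulgA u x) ux -(mulgA y) mulgV mulg1 -expg2 -xy.1 mulgA.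
  by rewrite -mulgA -!expgS tet_x4.
- by rewrite -mulgA uVy.
- by rewrite -mulgA uVx !mulgA -expg2 cy expg2 -!mulgA.
Qed.

End TetRelTheory.

(** * The binary octahedral group *)

Lemma tet_rel_hom (G H : groupType) (f : {multiplicative G -> H}) x y u :
  tet_rel x y u -> tet_rel (f x) (f y) (f u).
Proof.
move=> [xy u3 ux uy]; split; first exact: dic_rel_hom.
- by rewrite -homX u3 hom1.
- by rewrite -gmulfM ux gmulfM.
- by rewrite -!gmulfM uy !gmulfM.
Qed.

Definition flip : {multiplicative tet -> tet} :=
  sval (tet_lift (tet_flip tet_relP)).

Lemma flipE : [/\ flip tetx = tety, flip tety = tetx & flip tetu = tetx * tetu^-1].
Proof. by rewrite /flip; case: tet_lift. Qed.

Lemma flipK : involutive flip.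
Proof.
have [fx fy fu] := flipE; have [_ _ ux _] := tet_relP.
apply: (tet_hom_ext (h := flip \o flip) (h' := idfun)); rewrite /= ?fx ?fy ?fu //.
by rewrite gmulfM homV fx fu invgM invgK mulgA -ux mulgK.
Qed.

Lemma tetx2C a : a * tetx ^+ 2 = tetx ^+ 2 * a.
Proof.
have [cx cy cu] := tet_x2C tet_relP.
pose c := mkhom (fun a b => conjMg a b (tetx ^+ 2)).
have fixed b : commute (tetx ^+ 2) b -> c b = b.
  by move=> cb; rewrite /= conjgE -cb mulKg.
have : c a = a by apply: (tet_hom_ext (h := c) (h' := idfun)); apply: fixed.
by move=> /= e; rewrite conjgC e.
Qed.

Fact flip_top : flip (tetx ^+ 2) = tetx ^+ 2.
Proof.
have [fx _ _] := flipE; have [[x2 _] _ _ _] := tet_relP.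
by rewrite homX fx x2.
Qed.

Fact flip_iter a : iter 2 flip a * tetx ^+ 2 = tetx ^+ 2 * a.
Proof. by rewrite -[RHS]tetx2C [iter 2 flip a](flipK a : _ = a). Qed.

Definition oct_data : cext_data tet 2 :=
  @CextData _ 2 flip (tetx ^+ 2) flip_top flip_iter.

Definition oct : finGroupType := cext oct_data.
Definition oct_base : {multiplicative tet -> oct} := cext_base oct_data.
Definition octv : oct := cext_gen oct_data.

(** The relations of an element v of O* of order 4 outside T*: it exchanges x and y. *)
Definition oct_rel (G : groupType) (x y u v : G) :=
  [/\ v ^+ 2 = x ^+ 2, v * x = y * v, v * y = x * v & v * u = x * u^-1 * v].

Lemma oct_relP : oct_rel (oct_base tetx) (oct_base tety) (oct_base tetu) octv.
Proof.
have [fx fy fu] := flipE; split.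
- by rewrite -homX; apply: cext_genXn.
- by rewrite [LHS]cext_gen_base fx.
- by rewrite [LHS]cext_gen_base fy.
- by rewrite [LHS]cext_gen_base fu gmulfM homV.
Qed.

(** An intertwining relation between two homomorphisms holds everywhere once it holds at
    generators. *)
Lemma oct_twist (G : groupType) (h : {multiplicative tet -> G}) (v : G) :
  oct_rel (h tetx) (h tety) (h tetu) v -> forall a, v * h a = h (flip a) * v.
Proof.
move=> [v2 vx vy vu] a; have [fx fy fu] := flipE.
pose c := mkhom (fun a b => conjMg a b v^-1).
have cE b : c b = v * b * v^-1 by rewrite /= conjgE invgK mulgA.
suff e : c (h a) = h (flip a) by rewrite -e cE mulgVK.
apply: (tet_hom_ext (h := c \o h) (h' := h \o flip)).
- by rewrite [LHS]cE [RHS]/= fx vx mulgK.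
- by rewrite [LHS]cE [RHS]/= fy vy mulgK.
- by rewrite [LHS]cE [RHS]/= fu gmulfM homV vu mulgK.
Qed.

Lemma oct_lift (G : groupType) (x y u v : G) : tet_rel x y u -> oct_rel x y u v ->
  exists2 h : {multiplicative oct -> G},
    [/\ h (oct_base tetx) = x, h (oct_base tety) = y & h (oct_base tetu) = u]
    & h octv = v.
Proof.
move=> xyu xyuv; have [h [hx hy hu]] := tet_lift xyu.
have vn : v ^+ 2 = h (top oct_data) by case: xyuv => [-> _ _ _]; rewrite homX hx.
have vh : forall a, v * h a = h (tw oct_data a) * v.
  by apply: oct_twist; rewrite hx hy hu.
exists (cext_lift vn vh); last exact: cext_lift_gen.
by split; rewrite [LHS]cext_lift_base.
Qed.

Lemma oct_generated (A : {group oct}) :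
    oct_base tetx \in A -> oct_base tety \in A -> oct_base tetu \in A ->
  octv \in A -> A = [set: oct] :> {set oct}.
Proof.
move=> Ax Ay Au Av; apply: cext_generated => // a.
have : a \in hom_morphism oct_base @*^-1 A.
  by rewrite (tet_generated (A := [group of hom_morphism oct_base @*^-1 A])) ?inE.
by rewrite !inE.
Qed.

Section OctahedralRelations.
Variables (G : groupType) (s t : G).
Hypotheses (e1 : t * s * t = s * s) (e2 : s * t * s = t ^+ 3).
Let z := s ^+ 3.

Fact oct_zt : z = t ^+ 4.
Proof. by rewrite /z !expg3 -e1 -!mulgA (mulgA s t s) e2 -expgS. Qed.

Fact oct_ct : commute z t.
Proof. rewrite oct_zt; exact/commute_sym/commuteX. Qed.

(** All of t, t s^-1, t^-1 s and s t^-1 are conjugate, and the last is the inverse of the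
    second. So t is conjugate to t^-1, and the central element z = t ^ 4 equals its
    inverse. *)
Fact oct_z2 : z * z = 1.
Proof.
have cs := poly_cs s; have ct := oct_ct.
have st : s * t = t * t * t * s^-1 by rewrite -expg3 -e2 mulgK.
have zt := esym oct_zt.
have p1 : (t * s^-1) ^+ 4 = z.
  apply: (conj_pow (a := t) (g := s^-1 * t)) => //.
    by apply: commuteM => //; apply: commuteV.
  have tsV : t * s^-1 = s^-1 * t^-1 * s.
    by apply: (mulgI (t * s)); rewrite !mulgA e1 !gnorm.
  by rewrite mulgA [in LHS]tsV -[LHS]mulgA st !gnorm.
have p2 : (t^-1 * s) ^+ 4 = z.
  apply: (conj_pow (a := t * s^-1) (g := t^-1)) => //; first exact: commuteV.
  by apply: (mulgI (t * t)); apply: (mulIg t); rewrite !gnorm st.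
have p3 : (s * t^-1) ^+ 4 = z.
  apply: (conj_pow (a := t^-1 * s) (g := t^-1)) => //; first exact: commuteV.
  by rewrite !mulgA.
have : (t * s^-1)^-1 ^+ 4 = z by rewrite invgM invgK.
by rewrite expVgn p1 => {2}<-; rewrite mulgV.
Qed.

(** The quaternion units of O* are the conjugates of t ^ 2, as t has order 8. *)
Lemma oct_rel_presented (x := t * t) (y := s * (t * t) * s^-1) :
  tet_rel x y (s * z) /\ oct_rel x y (s * z) (s * t).
Proof.
have x2 : x ^+ 2 = z by rewrite oct_zt (expgnA t 2 2).
have st : s * t = t * t * t * s^-1 by rewrite -expg3 -e2 mulgK.
have zV : z^-1 = z by apply: mulg1_eq; apply: oct_z2.
split.
  apply: tet_rel_of_cube => //; first by apply: commuteM; apply: oct_ct.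
    exact: oct_z2.
  apply: (mulIg (s * s)); rewrite !mulgA !mulgVK /x.
  transitivity (t * (t * s * t) * (t * s)); first by rewrite !mulgA.
  rewrite e1; transitivity (t * s * (s * t * s)); first by rewrite !mulgA.
  by rewrite e2 -e1 expg3 !mulgA.
split; rewrite ?x2 /x /y.
- by rewrite expg2 -mulgA (mulgA t) e1 /z expg3 mulgA.
- by rewrite !mulgA mulgVK.
- by rewrite !mulgA e2 -[RHS]mulgA st expg3 !mulgA.
- rewrite invgM zV; have := oct_ct; move: (z) => w ct.
  by rewrite !mulgA e2 expg3 mulgVK -[LHS]mulgA -ct mulgA.
Qed.
End OctahedralRelations.

(** * Presentations of the polyhedral groups *)

Section PolyhedralPresentation.
Variable n : nat.

Definition poly_rel (G : groupType) (r s t : G) :=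
  [/\ r ^+ 2 = r * s * t, s ^+ 3 = r * s * t & t ^+ n.+1 = r * s * t].

Lemma poly_homgP (gT : finGroupType) (H : {set gT}) :
  (H \homg Grp (r : s : t :
     r ^+ 2 = r * s * t, s ^+ 3 = r * s * t, t ^+ n.+1 = r * s * t)) <->
  exists r s t, H = <[r]> <*> <[s]> <*> <[t]> /\ poly_rel r s t.
Proof.
split=> [/existsP[[[r s] t]] /=|[r [s [t [-> [e1 e2 e3]]]]]].
  rewrite !xpair_eqE /= => /and4P[/eqP <- /eqP e1 /eqP e2 /eqP e3].
  by exists r, s, t.
by apply/existsP; exists (r, s, t); rewrite /= !xpair_eqE /= e1 e2 e3 !eqxx.
Qed.

(** The generator r is redundant; the relations become two braid-like ones in s and t. *)
Lemma poly_relE (G : groupType) (r s t : G) : poly_rel r s t ->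
  [/\ r = s * t, t * s * t = s * s & s * t * s = t ^+ n].
Proof.
move=> [e1 e2 e3]; have rE : r = s * t.
  by apply: (mulgI r); rewrite -expg2 e1 mulgA.
split=> //.
  by apply: (mulgI s); rewrite !mulgA -rE -e2 expg3.
by apply: (mulIg t); rewrite -rE -[LHS]mulgA -rE -expgSr e3 rE !mulgA.
Qed.

(** The presentation is that of G as soon as generators of G satisfy it and are universal
    among finite groups. *)
Lemma poly_iso (G : finGroupType) (r s t : G) : poly_rel r s t ->
    [set: G] = <[r]> <*> <[s]> <*> <[t]> ->
    (forall (H : finGroupType) (r' s' t' : H), poly_rel r' s' t' ->
      exists h : {multiplicative G -> H}, [/\ h r = r', h s = s' & h t = t']) ->
  [set: G] \isog Grp (r : s : t :
     r ^+ 2 = r * s * t, s ^+ 3 = r * s * t, t ^+ n.+1 = r * s * t).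
Proof.
move=> rst Grst univ.
apply: (intro_isoGrp (G := [group of [set: G]])) => [|rT H].
  by apply/poly_homgP; exists r, s, t.
case/poly_homgP=> r' [s' [t' [-> /univ[h [<- <- <-]]]]].
exact: homg_joing3.
Qed.

End PolyhedralPresentation.

Section PolyhedralGenerators.
Variables (G : groupType) (x y u : G).
Hypothesis xyu : tet_rel x y u.
Let s := u * x ^+ 2.

Fact tet_s3 : s ^+ 3 = x ^+ 2.
Proof.
have [_ _ cu] := tet_x2C xyu; have [_ u3 _ _] := xyu.
by rewrite expgMn // u3 mul1g -expgnA (expgnDr x 4 2) (tet_x4 xyu) mul1g.
Qed.

Fact tet_sV : s^-1 = u^-1 * x ^+ 2.
Proof.
have [_ _ cu] := tet_x2C xyu; rewrite /s -cu invgM; congr (_ * _).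
by apply: mulg1_eq; rewrite -expgnDr (tet_x4 xyu).
Qed.

(** The generators of the presentation inside Q8 extended by u are r = x, s = u x ^ 2 of
    order 6, and t = s^-1 r. *)
Lemma tet_poly_rel : poly_rel 2 x s (s^-1 * x).
Proof.
have [cx _ cu] := tet_x2C xyu; have [_ xu3 _ _] := tet_flip xyu.
split; rewrite -?[x * s * _]mulgA mulVKg -?expg2 ?tet_s3 //.
rewrite tet_sV -mulgA cx mulgA expgMn; last first.
  by apply/commute_sym/commuteM => //; apply: commuteV.
rewrite -expgnA (expgnDr x 4 2) (tet_x4 xyu) mul1g (_ : _ ^+ 3 = 1) ?mul1g //.
apply: (conj_pow (a := x * u^-1) (g := x)) => //.
  exact/commute_sym/commute1.
by rewrite -mulgA.
Qed.

(** Recovers the quaternion unit x as the square of the generator t of order 8. *)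
Lemma oct_square v : oct_rel x y u v -> (s^-1 * v) ^+ 2 = x.
Proof.
move=> [v2 _ _ vu].
have vs : v * s = x * s^-1 * v.
  have cv : commute (x ^+ 2) v by rewrite -v2; apply/commute_sym/commuteX.
  rewrite /s mulgA vu tet_sV; move: (x ^+ 2) cv => z cv.
  by rewrite -!mulgA cv.
have tE : s^-1 * v = x^-1 * (v * s) by rewrite vs -!mulgA mulKg.
rewrite expg2 {1}tE (mulgA x^-1) mulgA mulgK -mulgA -expg2 v2 expg2.
exact: mulKg.
Qed.

Lemma oct_poly_rel v : oct_rel x y u v -> poly_rel 3 v s (s^-1 * v).
Proof.
move=> xyuv; have [v2 _ _ _] := xyuv.
split; rewrite -?[v * s * _]mulgA mulVKg -?expg2 ?tet_s3 //.
by rewrite (expgnA _ 2 2) (oct_square xyuv) v2.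
Qed.

End PolyhedralGenerators.

Lemma tet_rel_mem (G : finGroupType) (A : {group G}) (x y u : G) :
  tet_rel x y u -> x \in A -> u * x ^+ 2 \in A -> y \in A /\ u \in A.
Proof.
move=> [_ _ ux _] Ax; rewrite (groupMr _ (groupX 2 Ax)) => Au.
by split=> //; rewrite -(mulgK u y) -ux !groupM ?groupV.
Qed.

Lemma is_binary_tetrahedral_tet : is_binary_tetrahedral tet.
Proof.
apply: poly_iso (tet_poly_rel tet_relP) _ _.
  apply: joing3_setT => A Ax As _.
  have [Ay Au] := tet_rel_mem tet_relP Ax As.
  exact: tet_generated.
move=> H r s t /poly_relE[-> e1 e2].
have rel := tet_rel_presented e1 e2; have [h [hx _ hu]] := tet_lift rel.
have x2 : (s * t) ^+ 2 = s ^+ 3 by rewrite expg2 -mulgA (mulgA t) e1 expg3 mulgA.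
have hs : h (tetu * tetx ^+ 2) = s.
  by rewrite gmulfM homX hx hu x2 -mulgA (tet_z2 e1 e2) mulg1.
by exists h; split=> //; rewrite gmulfM homV hs hx mulKg.
Qed.

Lemma is_binary_octahedral_oct : is_binary_octahedral oct.
Proof.
have xyu := tet_rel_hom oct_base tet_relP.
apply: poly_iso (oct_poly_rel xyu oct_relP) _ _.
  apply: joing3_setT => A Av As At.
  have Ax : oct_base tetx \in A.
    by rewrite -(oct_square xyu oct_relP) groupX.
  have [Ay Au] := tet_rel_mem xyu Ax As.
  exact: oct_generated.
move=> H r s t /poly_relE[-> e1 e2].
have [rel1 rel2] := oct_rel_presented e1 e2.
have [h [hx _ hu] hv] := oct_lift rel1 rel2.
have x2 : (t * t) ^+ 2 = s ^+ 3 by rewrite (oct_zt e1 e2) (expgnA t 2 2).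
have hs : h (oct_base tetu * oct_base tetx ^+ 2) = s.
  by rewrite gmulfM homX hx hu x2 -mulgA (oct_z2 e1 e2) mulg1.
by exists h; split=> //; rewrite gmulfM homV hs hv mulKg.
Qed.

Lemma is_binary_tetrahedral_iso G : is_binary_tetrahedral G -> group_iso tet G.
Proof. exact/presented_iso/is_binary_tetrahedral_tet. Qed.

Lemma is_binary_octahedral_iso G : is_binary_octahedral G -> group_iso oct G.
Proof. exact/presented_iso/is_binary_octahedral_oct. Qed.

(** * Embeddings of the binary tetrahedral group *)

Section Projection.
Variables (F : finGroupType) (n' : nat).
Local Notation n := n'.+1.
Variable D : cext_data F n.

(** The quotient by F, onto the cyclic group of order n. *)
Lemma cext_kernel : exists h : {multiplicative cext D -> cyc n},
  [/\ forall a, h (cext_base D a) = 1, h (cext_gen D) = cgen n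
    & forall w, h w = 1 -> exists a, w = cext_base D a].
Proof.
have vn : cgen n ^+ n = @one_fun F (cyc n) (top D) by rewrite cgenX.
have vh x : cgen n * @one_fun F (cyc n) x = one_fun _ (tw D x) * cgen n.
  by rewrite mulg1 mul1g.
exists (cext_lift vn vh); split=> [a||w].
- exact: cext_lift_base.
- exact: cext_lift_gen.
move=> hw; have w2 : n %| w.2.
  by rewrite -(cgenX_eq1 (ltn0Sn n')) -hw /= mul1g.
exists w.1; rewrite [LHS]cext_eq; have -> : nat_of_ord w.2 = 0.
  by case: (posnP w.2) => // /dvdn_leq/(_ w2); rewrite leqNgt ltn_ord.
exact: mulg1.
Qed.

End Projection.

(** Stated without inverses, so that the conjugate is compared with h by cancellation. *)
Lemma conj_hom (G H : groupType) (h : {multiplicative G -> H}) (g : H) :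
  exists c : {multiplicative G -> H}, forall a, g * c a = h a * g.
Proof.
exists (mkhom (fun a b => conjMg a b g) \o h) => a.
by rewrite /= -conjgC.
Qed.

Lemma conj_invert (G : groupType) (x y g w : G) :
  y * x = x^-1 * y -> g * w = x * g -> y * g * w^-1 = x * (y * g).
Proof.
move=> yx gw; have -> : x * (y * g) = y * x^-1 * g.
  by rewrite mulgA; congr (_ * _); apply: (mulIg x); rewrite mulgVK -mulgA yx mulVKg.
by apply: (mulIg w); rewrite mulgVK -!mulgA gw mulKg.
Qed.

Lemma dic2_noncomm (G : groupType) (f : {multiplicative dic 2 -> G}) :
  injective f -> ~ commute (f (dicx 2)) (f (dicy 2)).
Proof.
move=> f_inj; rewrite /commute -!gmulfM => /f_inj e.
have := (dic_relP 2).2; rewrite -e => /mulIg /(congr1 (mul (dicx 2))).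
rewrite mulgV -expg2 => /eqP.
by rewrite (frame_xX1 (dic_frame_dic (isT : 0 < 2))).
Qed.

Section TetConjugacy.
Local Notation X := (dicx 2).
Local Notation Y := (dicy 2).
Local Notation tbase := (cext_base tet_data).

(** Modulo Q8 the order divides both 3 and 4. *)
Lemma tet_order4 (w : tet) : w ^+ 4 = 1 -> exists b, w = tbase b.
Proof.
move=> w4; have [h [_ _ hker]] := cext_kernel tet_data; apply: hker.
have := congr1 h w4; rewrite homX hom1 expgSr.
have [i ->] := cyc_form (h w).
by rewrite -expgnA [(i * 3)%N]mulnC expgnA cgenX expg1n mul1g.
Qed.

Lemma quat_order4 (b : dic 2) : b ^+ 2 <> 1 ->
  exists2 c, [\/ c = X, c = Y | c = X * Y] & b = c \/ b = c^-1.
Proof.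
have x4 : X ^+ 4 = 1 := dic_x2m (dic_relP 2).
have [i e] := dic_form b.
have {}e : exists2 i, i < 4 & b = X ^+ i \/ b = X ^+ i * Y.
  exists (i %% 4); first by rewrite ltn_mod.
  by rewrite expg_mod.
case: e => [[|[|[|[|//]]]] _ [] -> b2].
- by case: b2; rewrite expg1n.
- by exists Y; [constructor 2|left; rewrite mul1g].
- by exists X; [constructor 1|left].
- by exists (X * Y); [constructor 3|left].
- by case: b2.
- by exists Y; [constructor 2|right; apply/eqP].
- by exists X; [constructor 1|right; apply/eqP].
- by exists (X * Y); [constructor 3|right; apply/eqP].
Qed.

(** The elements of order 4 of T* form one conjugacy class: u permutes the three units
    cyclically, and y inverts x. *)
Lemma tet_conj_x (w : tet) : w ^+ 4 = 1 -> w ^+ 2 <> 1 ->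
  exists g, g * w = tetx * g.
Proof.
move=> /tet_order4[b ->] b2; have [xy u3 ux uy] := tet_relP.
have [uVy uVx _] := tet_uV tet_relP.
have [|c c3 bc] := @quat_order4 b.
  by move=> b2'; apply: b2; rewrite -homX b2' hom1.
have [g gc] : exists g, g * tbase c = tetx * g.
  case: c3 => ->.
  - by exists 1; rewrite mul1g mulg1.
  - by exists tetu^-1.
  - by exists tetu; rewrite gmulfM; apply: (tet_uxy tet_relP).
case: bc => ->; first by exists g.
by exists (tety * g); rewrite homV; apply: conj_invert gc; case: xy.
Qed.

End TetConjugacy.

(** The image of Y is in Q8 by its order, and outside <x> as it does not commute with x. *)
Lemma tet_fix_y (f : {multiplicative tet -> tet}) :
  injective f -> f tetx = tetx -> exists i, f tety = tetx ^+ i * tety.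
Proof.
move=> f_inj fx; have [[x2 _] _ _ _] := tet_relP.
have [|b fy] := @tet_order4 (f tety).
  by rewrite -homX (expgnA tety 2 2) -x2 -expgnA (tet_x4 tet_relP) hom1.
have [i [bE|bE]] := dic_form b; last first.
  by exists i; rewrite fy bE gmulfM homX.
case: (@dic2_noncomm _ (f \o cext_base tet_data)).
  exact/(inj_comp f_inj)/cext_base_inj.
rewrite /= [f (cext_base _ _)]fx [f (cext_base _ (dicy 2))]fy bE homX.
exact/commuteX/commute_refl.
Qed.

(** The centralizer of Q8 in T* is the center. If b u ^ n with b in Q8 commutes with x,
    then b conjugates u ^ n x u ^ -n to x. For n = 1, 2 the former is y, xy; but conjugate
    elements agree in the abelianization of Q8, where x differs from y and xy, as the
    homomorphism h0 shows. *)
Lemma tet_centralizer (w : tet) :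
  commute w tetx -> commute w tety -> w ^+ 2 = 1 /\ commute w tetu.
Proof.
have [h0 [h0x h0y]] : exists h : {multiplicative dic 2 -> cyc 2},
    h (dicx 2) = 1 /\ h (dicy 2) = cgen 2.
  have rel : dic_rel 2 (1 : cyc 2) (cgen 2).
    by split; rewrite ?cgenX ?expg1n // invg1 mulg1 mul1g.
  by have [h hx hy] := dic_lift rel isT; exists h.
have u1 : cgen 2 <> 1.
  by move/eqP; rewrite -[cgen 2]expg1 cgenX_eq1.
have twx (b : dic 2) n :
    cext_base tet_data b * tetu ^+ n * tetx = tetx * (cext_base tet_data b * tetu ^+ n) ->
    h0 (iter n rotate (dicx 2)) = 1.
  have swp : tetu ^+ n * tetx = cext_base tet_data (iter n rotate (dicx 2)) * tetu ^+ n.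
    elim: n => [|n IHn]; first by rewrite mulg1 mul1g.
    by rewrite !expgS -mulgA IHn mulgA [tetu * _]cext_gen_base -mulgA.
  rewrite -mulgA swp !mulgA => /mulIg; rewrite -!gmulfM => /cext_base_inj /(congr1 h0).
  by rewrite !gmulfM h0x mul1g => e; apply: (mulgI (h0 b)); rewrite e mulg1.
have [b [n [lt_n ->]]] : exists b n, n < 3 /\ w = cext_base tet_data b * tetu ^+ n.
  by exists w.1, w.2; split; [exact: ltn_ord|exact: cext_eq].
move=> wx wy.
have n0 : n = 0.
  move: (twx b n wx); case: n lt_n {wx wy} => [|[|[|//]]] _ //=.
    by rewrite rotate_x h0y => /u1.
  by rewrite rotate_x rotate_y gmulfM h0x h0y mul1g => /u1.
rewrite n0 mulg1 in wx wy *.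
have bx : b * dicx 2 = dicx 2 * b.
  by apply: (@cext_base_inj _ _ tet_data); rewrite !gmulfM.
have bY : b * dicy 2 = dicy 2 * b.
  by apply: (@cext_base_inj _ _ tet_data); rewrite !gmulfM.
have [i [bE|bE]] := dic_form b; last first.
  case: (@dic2_noncomm _ idfun) => //=; rewrite /commute.
  apply/esym/(mulgI (dicx 2 ^+ i)); rewrite !mulgA -bE bx bE mulgA -expgS -expgSr //.
have i2 : 2 %| i.
  move: bY; rewrite bE (dic_yX (dic_relP 2)) => /mulIg /(congr1 (mul (dicx 2 ^+ i))).
  rewrite mulgV -expgnDr addnn -muln2 => /eqP.
  by rewrite (frame_xX1 (dic_frame_dic (isT : 0 < 2))) (@dvdn_pmul2r 2 2 i).
case/dvdnP: i2 => j ij.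
have -> : cext_base tet_data b = tetx ^+ 2 ^+ j by rewrite bE homX ij mulnC expgnA.
split; first by rewrite expgnAC -(expgnA tetx 2 2) (tet_x4 tet_relP) expg1n.
exact/commute_sym/commuteX/tetx2C.
Qed.

Lemma oct_tet_cube (w : oct) : w ^+ 3 = 1 -> exists a, w = oct_base a.
Proof.
move=> w3; have [h [_ _ hker]] := cext_kernel oct_data; apply: hker.
have := congr1 h w3; rewrite homX hom1 expgS; have [i ->] := cyc_form (h w).
by rewrite -expgnA [(i * 2)%N]mulnC expgnA cgenX expg1n mulg1.
Qed.

Lemma inj_commute (G H : groupType) (f : {multiplicative G -> H}) a b :
  injective f -> commute (f a) (f b) -> commute a b.
Proof. by move=> f_inj c; apply: f_inj; rewrite !gmulfM. Qed.

Lemma tet_quotient_commute (G : groupType) (x y u a : G) :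
  tet_rel x y u -> tet_rel x y a -> commute (u^-1 * a) x /\ commute (u^-1 * a) y.
Proof.
move=> xyu [_ _ ax ay]; have [_ _ _ uy] := xyu; have [uVy _ _] := tet_uV xyu.
split; first by rewrite /commute -mulgA ax !mulgA uVy.
rewrite /commute -mulgA ay; apply: (mulgI u).
by rewrite mulVKg [RHS]mulgA uy -[RHS]mulgA mulVKg.
Qed.

Lemma tet_quotient_eq1 (G : groupType) (x y u a : G) :
    tet_rel x y u -> tet_rel x y a ->
  (u^-1 * a) ^+ 2 = 1 -> commute (u^-1 * a) u -> a = u.
Proof.
move=> [_ u3 _ _] [_ a3 _ _] c2 cu.
have : (u * (u^-1 * a)) ^+ 3 = 1 by rewrite mulVKg.
rewrite expgMn // u3 mul1g expgS c2 mulg1 => /(congr1 (mul u)).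
by rewrite mulVKg mulg1.
Qed.

(** An element of order 3 that permutes the units as u does differs from u by a central
    element, whose order divides both 2 and 3. *)
Lemma oct_u_unique (w : oct) :
  tet_rel (oct_base tetx) (oct_base tety) w -> w = oct_base tetu.
Proof.
move=> rel; have [a wa] : exists a, w = oct_base a by apply: oct_tet_cube; case: rel.
have inj := @cext_base_inj _ _ oct_data.
have xyu := tet_rel_hom oct_base tet_relP.
move: rel; rewrite wa => rel.
have [cx cy] := tet_quotient_commute xyu rel.
have qE : oct_base (tetu^-1 * a) = (oct_base tetu)^-1 * oct_base a.
  by rewrite gmulfM homV.
have [||c2 cu] := @tet_centralizer (tetu^-1 * a).
- by apply: (@inj_commute _ _ oct_base) inj _; rewrite qE; exact: cx.
- by apply: (@inj_commute _ _ oct_base) inj _; rewrite qE; exact: cy.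
apply: (tet_quotient_eq1 xyu rel); rewrite -qE; first by rewrite -homX c2 hom1.
exact: gmulf_commute.
Qed.

Lemma tetx2_neq1 : tetx ^+ 2 <> 1.
Proof.
rewrite -homX -(hom1 (cext_base tet_data)) => /cext_base_inj /eqP.
by rewrite (frame_xX1 (dic_frame_dic (isT : 0 < 2))).
Qed.

Lemma twist_pow (G : groupType) (g x y : G) i :
    g * x = x * g -> g * y = x * y * g ->
  g ^+ i * x = x * g ^+ i /\ g ^+ i * y = x ^+ i * y * g ^+ i.
Proof.
move=> gx gy; split; first exact/commute_sym/commuteX.
elim: i => [|i IHi]; first by rewrite mulg1 !mul1g.
rewrite [g ^+ i.+1]expgS -mulgA IHi !mulgA (commuteX i gx) -(mulgA _ g) gy.
by rewrite expgSr !mulgA.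
Qed.

(** The element u^-1 v of order 8 rotates y to xy around x; its powers move y to every
    x ^ i y. *)
Lemma oct_quarter_turn (G : groupType) (x y u v : G) (g := u^-1 * v) :
  tet_rel x y u -> oct_rel x y u v -> g * x = x * g /\ g * y = x * y * g.
Proof.
move=> xyu [_ vx vy _]; have [uVy uVx _] := tet_uV xyu.
by split; rewrite -mulgA ?vx ?vy !mulgA ?uVy ?uVx.
Qed.

(** Automorphisms of T* are conjugations by elements of O*: conjugate f(x) back to x
    inside T*, then f(y) back to y by a quarter turn around x; after that f(u) = u by
    [oct_u_unique]. *)
Lemma oct_inner (f : {multiplicative tet -> tet}) : injective f ->
  exists g, forall a, oct_base (f a) * g = g * oct_base a.
Proof.
move=> f_inj; have x4 := tet_x4 tet_relP.
(* k moves f(x) back to x, and f1 is f followed by conjugation by k *)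
have [|x2|k kx] := @tet_conj_x (f tetx).
- by rewrite -homX x4 hom1.
- have : f (tetx ^+ 2) = f 1 by rewrite homX x2 hom1.
  by move/f_inj/tetx2_neq1.
have [f1 f1P] := conj_hom f k^-1.
have f1_inj : injective f1.
  by move=> a b e; apply: f_inj; apply: (mulIg k^-1); rewrite -!f1P e.
have f1x : f1 tetx = tetx.
  by apply: (mulgI k^-1); rewrite f1P; apply: (mulgI k); rewrite mulgA kx mulgK mulVKg.
have [i f1y] := tet_fix_y f1_inj f1x.
have xyu := tet_rel_hom oct_base tet_relP.
(* g is the i-th power of the quarter turn, so c agrees with the inclusion at x and y *)
have [g0x g0y] := oct_quarter_turn xyu oct_relP.
have [gx gy] := twist_pow i g0x g0y; move: (_ ^+ i) gx gy => g gx gy.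
have [c cP0] := conj_hom (oct_base \o f1) g.
have cP a : g * c a = oct_base (f1 a) * g := cP0 a.
have cx : c tetx = oct_base tetx.
  by apply: (mulgI g); rewrite cP f1x gx.
have cy : c tety = oct_base tety.
  by apply: (mulgI g); rewrite cP f1y gy gmulfM homX.
have cu : c tetu = oct_base tetu.
  by apply: oct_u_unique; rewrite -cx -cy; apply: tet_rel_hom tet_relP.
have cE := tet_hom_ext cx cy cu.
exists (oct_base k^-1 * g) => a.
have e : oct_base (f a) * oct_base k^-1 = oct_base k^-1 * oct_base (f1 a).
  transitivity (oct_base (f a * k^-1)); first by rewrite gmulfM.
  by rewrite -f1P gmulfM.
by rewrite mulgA e -[LHS]mulgA -[RHS]mulgA -(cE a) cP.
Qed.

(** T* has no quotient of order 2: x is a commutator, y is conjugate to x, and u has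
    order 3. *)
Lemma tet_hom_trivial (h : {multiplicative tet -> cyc 2}) a : h a = 1.
Proof.
have [_ u3 ux uy] := tet_rel_hom h tet_relP.
have order2 w : w ^+ 2 = 1 :> cyc 2.
  by have [i ->] := cyc_form w; rewrite expgnAC cgenX expg1n.
have hx : h tetx = 1.
  by apply: (mulIg (h tety * h tetu)); rewrite mul1g mulgA -uy cyc_commute.
have hy : h tety = 1 by apply: (mulIg (h tetu)); rewrite mul1g -ux hx mulg1.
have hu : h tetu = 1 by rewrite -u3 expgS order2 mulg1.
by apply: (tet_hom_ext (h' := @one_fun tet (cyc 2))).
Qed.

(** If f is conjugate to the standard inclusion by g, the conjugate of the adjoined
    element by g serves for f. *)
Lemma realizes_inner (F : finGroupType) (D : cext_data F 2)
    (f : {multiplicative F -> cext D}) (g : cext D) :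
  (forall a, f a * g = g * cext_base D a) -> realizes D f.
Proof.
move=> fg; have fE a : f a = g * cext_base D a * g^-1 by rewrite -fg mulgK.
exists (g * cext_gen D * g^-1); split=> [a||a].
- rewrite fE => /mulIg /mulgI /(congr1 snd) /(congr1 val) //.
- by rewrite expg2 fE -cext_genXn expg2 !mulgA mulgVK.
- by rewrite !fE !mulgA !mulgVK -(mulgA g) cext_gen_base mulgA.
Qed.

Lemma realizes_comp (F G H : finGroupType) (D : cext_data F 2)
    (f : {multiplicative F -> G}) (t : {multiplicative G -> H}) :
  injective t -> realizes D f -> realizes D (t \o f).
Proof.
move=> t_inj [v [fv v2 vf]]; exists (t v); split=> [a /t_inj /fv //||a].
  by rewrite -homX v2.
by rewrite -gmulfM vf gmulfM.
Qed.

Lemma octahedral_realizes (G : finGroupType) (f : {multiplicative tet -> G}) :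
  is_binary_octahedral G -> index2_embedding f -> realizes oct_data f.
Proof.
move=> /is_binary_octahedral_iso[t [t' tK t'K]] [f_inj _].
have [f' f'_inj fE] : exists2 f' : {multiplicative tet -> oct},
    injective f' & forall a, t (f' a) = f a.
  exists (mkhom (can2_gmulfM tK t'K) \o f) => [|a]; last exact: t'K.
  by apply: inj_comp f_inj; apply: can_inj t'K.
have [h [_ _ hker]] := cext_kernel oct_data.
have img a : exists b, oct_base b = f' a.
  by have [b e] := hker _ (tet_hom_trivial (h \o f') a); exists b; apply/esym/e.
have [phi phiE] := choice img.
have phiM : {morph phi : a b / a * b}.
  move=> a b; apply: (@cext_base_inj _ _ oct_data).
  by rewrite gmulfM [LHS]phiE gmulfM -!phiE.
have [|g gP] := @oct_inner (mkhom phiM).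
  by move=> a b /= e; apply: f'_inj; rewrite -!phiE e.
have : realizes oct_data f'.
  by apply: (@realizes_inner _ _ f' g) => a; rewrite -phiE; apply: gP.
move/(realizes_comp (can_inj tK)) => [v [fv v2 vf]].
exists v; split=> [a||a]; rewrite -?fE //; [exact: fv|exact: vf].
Qed.

(** * The classification *)

Local Close Scope group_scope.

Theorem proposition11 :
  (* (a) *)
  (forall q : nat, 1 <= q ->
    exactly_iso_classes 1
      (amalgam_form (is_cyclic (4 * q)) (is_cyclic (2 * q)) (is_cyclic (4 * q))))
  /\ (* (b) *)
  (forall q : nat, 2 <= q ->
    exactly_iso_classes 1
      (amalgam_form (is_cyclic (4 * q)) (is_cyclic (2 * q)) (is_dicyclic q)))
  /\ (* (c) *)
  (forall q : nat, 2 <= q ->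
    exactly_iso_classes 1
      (amalgam_form (is_dicyclic q) (is_cyclic (2 * q)) (is_dicyclic q)))
  /\ (* (d), where Dic_(2q) = Dic_(4(q/2)); two classes exactly when q = 4 *)
  (forall q : nat, 4 <= q -> ~~ odd q ->
    exactly_iso_classes (if q == 4 then 2 else 1)
      (amalgam_form (is_dicyclic q) (is_dicyclic q./2) (is_dicyclic q)))
  /\ (* (e) *)
  exactly_iso_classes 1
    (amalgam_form is_binary_octahedral is_binary_tetrahedral is_binary_octahedral).
Proof.
have cyc_gt0 q : 0 < q -> 0 < 2 * q by rewrite muln_gt0.
split=> [q q_gt0|].
  apply: (@one_class _ _ _ _ (cyc_data q) (cyc_data q)).
  - exact/is_cyclic_cyc/cyc_gt0.
  - by move=> F; apply/is_cyclic_iso/cyc_gt0.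
  - exact: is_cyclic_cext.
  - by move=> G f; apply: cyclic_realizes.
  - exact: is_cyclic_cext.
  - by move=> G f; apply: cyclic_realizes.
split=> [q q_gt1|].
  have q_gt0 := ltnW q_gt1.
  apply: (@one_class _ _ _ _ (cyc_data q) (dic_data q)).
  - exact/is_cyclic_cyc/cyc_gt0.
  - by move=> F; apply/is_cyclic_iso/cyc_gt0.
  - exact: is_cyclic_cext.
  - by move=> G f; apply: cyclic_realizes.
  - exact: is_dicyclic_dic.
  - by move=> G f; apply: dicyclic_realizes.
split=> [q q_gt1|].
  have q_gt0 := ltnW q_gt1.
  apply: (@one_class _ _ _ _ (dic_data q) (dic_data q)).
  - exact/is_cyclic_cyc/cyc_gt0.
  - by move=> F; apply/is_cyclic_iso/cyc_gt0.
  - exact: is_dicyclic_dic.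
  - by move=> G f; apply: dicyclic_realizes.
  - exact: is_dicyclic_dic.
  - by move=> G f; apply: dicyclic_realizes.
split=> [q q_ge4 q_even|].
  have [->|q_neq4] := eqVneq q 4; first exact: q16_two_classes.
  have qm : q = (2 * q./2)%N by rewrite mul2n even_halfK.
  move: (q./2) qm => m qm; subst q.
  have m_gt2 : 2 < m.
    rewrite ltn_neqAle -(@leq_pmul2l 2) // q_ge4 andbT.
    by apply: contraNneq q_neq4 => <-.
  have m_gt0 : 0 < m by apply: leq_trans m_gt2.
  apply: (@one_class _ _ _ _ (half_data m_gt0) (half_data m_gt0)).
  - exact: is_dicyclic_dic.
  - by move=> F; apply: is_dicyclic_iso.
  - exact: is_dicyclic_cext.
  - by move=> G f; apply: half_realizes_large.
  - exact: is_dicyclic_cext.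
  - by move=> G f; apply: half_realizes_large.
apply: (@one_class _ _ _ _ oct_data oct_data).
- exact: is_binary_tetrahedral_tet.
- exact: is_binary_tetrahedral_iso.
- exact: is_binary_octahedral_oct.
- by move=> G f; apply: octahedral_realizes.
- exact: is_binary_octahedral_oct.
- by move=> G f; apply: octahedral_realizes.
Qed.
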